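(* Let $\mathbb{F}$ be a finite field. The class of $\mathbb{F}$-representable matroids is efficiently pigeonhole, relative to the succinct representation of such matroids by matrices over $\mathbb{F}$.
   Context: All matroids are finite. The succinct representation $\Delta$ represents an $\mathbb{F}$-representable matroid $M$ by (a string describing) an $\mathbb{F}$-matrix representing $M$; the length of the string $\Delta(M)$ is taken to be bounded by a polynomial in $|E(M)|$. Succinct representation. For a class $\mathcal{M}$ of matroids, this is a relation $\Delta$ from $\mathcal{M}$ to finite binary strings ($\Delta(M)$ denotes any string related to $M$), together with a polynomial-time Turing machine which, given $(\Delta(M),X)$ with $M\in\mathcal{M}$ and $X\subseteq E(M)$, correctly decides whether $X$ is independent in $M$. For a matroid $M$ and $U\subseteq E(M)$, let $\lambda_M(U)=r_M(U)+r_M(E(M)-U)-r(M)$. For $X,X'\subseteq U$, write $X\sim_U X'$ if for every $Z\subseteq E(M)-U$, $X\cup Z$ is independent in $M$ iff $X'\cup Z$ is independent in $M$. Efficiently pigeonhole. A class $\mathcal{M}$ with succinct representation $\Delta$ is efficiently pigeonhole (relative to $\Delta$) if there are a Turing machine, a constant $c$, and a function $\pi$ from positive integers to positive integers such that the machine takes as input any tuple $(\Delta(M),U,X,X',\lambda)$ where $M\in\mathcal{M}$, $\lambda$ is a positive integer, $U\subseteq E(M)$ satisfies $\lambda_M(U)\le\lambda$, and $X,X'\subseteq U$; in time $O(\pi(\lambda)|E(M)|^c)$ it computes an equivalence relation $\approx_U$ on the subsets of $U$, in the sense that it accepts the tuple iff $X\approx_U X'$; and moreover (i) $X\approx_U X'$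 implies $X\sim_U X'$, and (ii) $\approx_U$ has at most $\pi(\lambda)$ equivalence classes. *)

(* Defs.v *)
From HB Require Import structures.
From Stdlib Require Import BinPos BinNat.
From mathcomp Require Import all_boot all_order all_algebra.

Set Implicit Arguments.
Unset Strict Implicit.
Unset Printing Implicit Defensive.

(** * Matroids *)

Record matroid := Matroid {
  ground :> finType;
  indep : pred {set ground};
  indep_set0 : indep set0;
  indep_subset : forall I J : {set ground}, I \subset J -> indep J -> indep I;
  indep_exchange : forall I J : {set ground},
    indep I -> indep J -> #|I| < #|J| ->
    exists2 e, e \in J :\: I & indep (e |: I)
}.

Definition rank (M : matroid) (X : {set M}) : nat :=
  \max_(I : {set M} | (I \subset X) && indep I) #|I|.

(* Submodularity of the rank makes the truncated subtraction exact. *)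
Definition connectivity (M : matroid) (U : {set M}) : nat :=
  rank U + rank (~: U) - rank [set: M].

Definition sim (M : matroid) (U X X' : {set M}) : Prop :=
  forall Z : {set M}, Z \subset ~: U -> indep (X :|: Z) = indep (X' :|: Z).

(* The columns of [A] are labelled by the elements of [M], in the order of
   [enum M]. *)
Definition represents (F : finFieldType) (M : matroid) (m : nat)
    (A : 'M[F]_(m, #|M|)) : Prop :=
  forall X : {set M}, indep X = free [seq col (enum_rank e) A | e <- enum X].

Definition representable (F : finFieldType) (M : matroid) : Prop :=
  exists (m : nat) (A : 'M[F]_(m, #|M|)), represents A.

(** * Deterministic multitape Turing machines *)

Inductive move := MoveLeft | Stay | MoveRight.

(* Input words are over the alphabet [option bool]: [Some b] is a bit and
   [None] is a separator. Tape [ord0] is the input tape. *)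
Record TM := MkTM {
  ntapes : nat;
  state : finType;
  sym : finType;
  blank : sym;
  inp : option bool -> sym;
  inp_inj : injective inp;
  inp_nblank : forall a, inp a != blank;
  start : state;
  verdict : state -> option bool;
  trans : state -> {ffun 'I_ntapes.+1 -> sym} ->
          state * {ffun 'I_ntapes.+1 -> sym * move}
}.

(* A two-way infinite tape: [tright] starts at the cell under the head, [tleft]
   is read leftwards from the head; cells beyond either list are blank. *)
Record tape (S : Type) := Tape { tleft : seq S; tright : seq S }.

Definition tread (S : Type) (b : S) (t : tape S) : S := head b (tright t).

Definition tact (S : Type) (b : S) (a : S * move) (t : tape S) : tape S :=
  let r := a.1 :: behead (tright t) in
  match a.2 with
  | MoveLeft => Tape (behead (tleft t)) (head b (tleft t) :: r)
  | Stay => Tape (tleft t) r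
  | MoveRight => Tape (a.1 :: tleft t) (behead r)
  end.

Record config (T : TM) := Config {
  cstate : state T;
  ctapes : 'I_(ntapes T).+1 -> tape (sym T)
}.

Definition init (T : TM) (x : seq (option bool)) : config T :=
  Config (start T)
    (fun i => Tape [::] (if i == ord0 then map (@inp T) x else [::])).

Definition step (T : TM) (c : config T) : config T :=
  if verdict (cstate c) is Some _ then c else
  let a := trans (cstate c) [ffun i => tread (blank T) (ctapes c i)] in
  Config a.1 (fun i => tact (blank T) (a.2 i) (ctapes c i)).

(* [Some true]: accepted within [t] steps; [Some false]: rejected within [t]
   steps; [None]: still running. *)
Definition result (T : TM) (x : seq (option bool)) (t : nat) : option bool :=
  verdict (cstate (iter t (@step T) (init T x))).

Definition polynomial_time (T : TM) : Prop :=
  exists K d : nat, forall x : seq (option bool),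
    result T x (K * (size x).+1 ^ d) != None.

(** * Encodings *)

Definition encode_tuple (ss : seq (seq bool)) : seq (option bool) :=
  flatten [seq rcons (map Some s) None | s <- ss].

Definition encode_set (E : finType) (X : {set E}) : seq bool :=
  [seq e \in X | e <- enum E].

(* Binary, least significant bit first. *)
Fixpoint encode_pos (p : positive) : seq bool :=
  match p with
  | xH => [:: true]
  | xO q => false :: encode_pos q
  | xI q => true :: encode_pos q
  end.

Definition encode_nat (n : nat) : seq bool :=
  if bin_of_nat n is Npos p then encode_pos p else [::].

(* One-hot, so of the fixed length #|F|. *)
Definition encode_scalar (F : finFieldType) (a : F) : seq bool :=
  [seq b == a | b <- enum F].

(* Column by column; [true] announces an entry, [false] ends the column. *)
Definition encode_matrix (F : finFieldType) (m n : nat) (A : 'M[F]_(m, n)) :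
    seq bool :=
  flatten [seq rcons (flatten [seq true :: encode_scalar (A i j)
                              | i <- enum 'I_m]) false
          | j <- enum 'I_n].

(** * Succinct representations and efficiently pigeonhole classes *)

Definition succinct_representation (cls : matroid -> Prop)
    (Delta : matroid -> seq bool -> Prop) : Prop :=
  (forall M, cls M -> exists w, Delta M w) /\
  exists T : TM, polynomial_time T /\
    forall (M : matroid) (w : seq bool) (X : {set M}), cls M -> Delta M w ->
      exists t, result T (encode_tuple [:: w; encode_set X]) t = Some (indep X).

(* [#|M|.+1] rather than [#|M|] keeps the bound O(pi lambda * #|M| ^ c)
   meaningful for the empty ground set; otherwise the two agree up to the
   constant 2 ^ c. The relation [R] may depend on the string [w] and on
   [lambda]. *)
Definition efficiently_pigeonhole (cls : matroid -> Prop)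
    (Delta : matroid -> seq bool -> Prop) : Prop :=
  succinct_representation cls Delta /\
  exists (T : TM) (c : nat) (pi : nat -> nat),
    (forall lambda, 0 < lambda -> 0 < pi lambda) /\
    exists K : nat,
    forall (M : matroid) (w : seq bool) (U : {set M}) (lambda : nat),
      cls M -> Delta M w -> 0 < lambda -> connectivity U <= lambda ->
      exists R : rel {set M},
        [/\ {in powerset U & &, equivalence_rel R},
            {in powerset U &, forall X X',
               result T (encode_tuple [:: w; encode_set U; encode_set X;
                                          encode_set X'; encode_nat lambda])
                 (K * (pi lambda * #|M|.+1 ^ c)) = Some (R X X')},
            {in powerset U &, forall X X', R X X' -> sim U X X'}
          & #|equivalence_partition R (powerset U)| <= pi lambda].

(* [Delta] assigns to each F-representable matroid one or more F-matrices
   representing it, of size polynomially bounded in that of the ground set. *)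
Definition matrix_representation (F : finFieldType)
    (Delta : matroid -> seq bool -> Prop) : Prop :=
  [/\ forall M, representable F M -> exists w, Delta M w,
      forall M w, representable F M -> Delta M w ->
        exists (m : nat) (A : 'M[F]_(m, #|M|)),
          represents A /\ w = encode_matrix A
    & exists K d : nat, forall M w, representable F M -> Delta M w ->
        size w <= K * #|M|.+1 ^ d].

(* Main.v *)
From HB Require Import structures.
From Stdlib Require Import BinPos BinNat.
Require Import Defs.
From mathcomp Require Import all_boot all_order all_algebra zify.
From mathcomp Require Import finfield.

Set Implicit Arguments.
Unset Strict Implicit.
Unset Printing Implicit Defensive.

Import GRing.Theory.
Local Open Scope ring_scope.
Local Open Scope nat_scope.

(** Let the columns of [A] represent [M], and write [span X] for the span of
    the columns labelled by [X] and [W] for [span (~: U)].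

    For [X] inside [U] and [Z] outside [U], the set [X :|: Z] is independent
    iff [X] and [Z] are and [span X] meets [span Z] in zero.  As [span Z] lies
    in [W], this last condition only involves [span X :&: W].  So the map that
    sends [X] to [span X :&: W], or to [None] when [X] is dependent, determines
    the class of [X] under [sim U]; the relation chosen for the theorem is that
    this map takes equal values ([same_traces], [same_traces_sim]).  Its
    values are subspaces of [span U :&: W], a space of dimension
    [connectivity U] ([connectivity_dim]), hence a set of at most
    [#|F| ^ lambda] vectors.  This gives at most [2 ^ (#|F| ^ lambda) + 1]
    classes ([card_classes]).

    Equality of traces is a question of Gaussian elimination.  To decide
    whether [span X :&: W] is contained in [span X'], double the coordinates:
    take [P] to consist of the vectors [(0, c)] for [c] a column of [X'], and
    [Q] of the vectors [(c, c)] for columns of [X] and [(c, 0)] for columns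
    outside [U].  The vectors in the span of [P ++ Q] whose first half is zero
    are the [(0, s + p)] with [s] in [span X :&: W] and [p] in [span X'], so
    the inclusion holds iff they all lie in the span of [P]
    ([contained_span]).  Elimination checks this: eliminate with the vectors of
    [P] first, then with those of [Q], always using as pivot the first nonzero
    entry.  A vector of [P] that has become zero reveals that [X'] is
    dependent, and a vector of [Q] whose first half has vanished but not its
    second half reveals that the inclusion fails ([eliminate_flags]).  The same
    elimination run on [P] alone tests independence.

    What remains is to run elimination on a Turing machine in polynomial time.
    The machines are obtained by compiling programs that operate on finitely
    many stacks with a finite memory: a tape whose head rests on the top symbol
    is a stack, and two machine steps implement one simultaneous push or pop on
    every stack ([exec_do], [exec_result]).  Each vector is used once as a
    pivot row and then discarded, so the whole matrix can live on a single
    stack; one sweep over that stack subtracts the right multiple of the pivot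
    row from all the other vectors ([exec_reduce_all], [exec_eliminate]).  The
    time is cubic in the length of the input, for arbitrary inputs in the case
    of the independence test ([independence_machine_halts]). *)

(** * Stack programs and their compilation to Turing machines *)

Section StackPrograms.

Variables (S memory : finType) (k : nat).

Inductive op := Keep | Pop | Push of S.

Definition do_op (o : op) (s : seq S) : seq S :=
  match o with Keep => s | Pop => behead s | Push a => a :: s end.

Notation store := (seq (seq S)).
Notation tops := (seq (option S)).

(** The operations of one instruction are listed sparsely: a stack that does
    not occur is kept. *)
Definition lookup (os : seq (nat * op)) (i : nat) : op :=
  foldr (fun p o => if p.1 == i then p.2 else o) Keep os.

Definition update (os : seq (nat * op)) (st : store) : store :=
  mkseq (fun i => do_op (lookup os i) (nth [::] st i)) (size st).

Definition instr := memory -> tops -> memory * seq (nat * op).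
Definition test := memory -> tops -> bool.

Inductive com :=
  | Do of instr
  | Seq of com & com
  | While of test & com.

Notation tapes := ('I_k.+1 -> tape (option S)).
Notation reads := {ffun 'I_k.+1 -> option S}.

(** The control points of a program, so that [ctrl c] is a finite type by
    recursion.  An elementary instruction has two: [None] before it, and
    [Some w] after its pops, when the symbols of [w] are still to be written. *)
Fixpoint ctrl (c : com) : finType :=
  match c with
  | Do _ => option reads
  | Seq a b => (ctrl a + ctrl b)%type
  | While _ c => option (ctrl c)
  end.

Fixpoint entry (c : com) : ctrl c :=
  match c with
  | Do _ => None
  | Seq a b => inl (entry a)
  | While _ c => None
  end.

Definition tops_of (r : reads) : tops := [seq r i | i <- enum 'I_k.+1].

Notation actions := {ffun 'I_k.+1 -> option S * move}.

Definition idle (r : reads) : actions := [ffun i => (r i, Stay)].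

(** Pushing takes two machine steps, because a machine writes before it moves:
    the head first moves to the free cell on its left, then writes there. *)
Definition prepare (r : reads) (os : seq (nat * op)) : actions :=
  [ffun i : 'I_k.+1 => match lookup os i with
            | Keep => (r i, Stay)
            | Pop => (None, MoveRight)
            | Push _ => (r i, MoveLeft)
            end].

Definition pushed (os : seq (nat * op)) : reads :=
  [ffun i : 'I_k.+1 => if lookup os i is Push a then Some a else None].

Definition write (r w : reads) : actions :=
  [ffun i => (if w i is Some a then Some a else r i, Stay)].

(** The control point [None] in the result means that the program exits. *)
Fixpoint ctrl_step (c : com) :
    ctrl c -> memory -> reads -> option (ctrl c) * memory * actions :=
  match c return ctrl c -> memory -> reads -> option (ctrl c) * memory * actions with
  | Do f => fun q m r =>
      if q is Some w then (None, m, write r w) else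
      let a := f m (tops_of r) in
      (Some (Some (pushed a.2)), a.1, prepare r a.2)
  | Seq a b => fun q m r =>
      match q with
      | inl q => let x := ctrl_step q m r in
          (Some (if x.1.1 is Some q' then inl q' else inr (entry b)),
           x.1.2, x.2)
      | inr q => let x := ctrl_step q m r in
          (omap inr x.1.1, x.1.2, x.2)
      end
  | While b c => fun q m r =>
      match q with
      | None => (if b m (tops_of r) then Some (Some (entry c)) else None,
                 m, idle r)
      | Some q => let x := ctrl_step q m r in (Some x.1.1, x.1.2, x.2)
      end
  end.

Definition heads (ts : tapes) : reads := [ffun i => tread None (ts i)].

Definition act (a : actions) (ts : tapes) : tapes :=
  fun i => tact None (a i) (ts i).

Inductive runs (c : com) : nat -> ctrl c -> memory -> tapes -> memory -> tapes -> Prop :=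
  | runs_exit q m ts m' a :
      ctrl_step q m (heads ts) = (None, m', a) ->
      runs 1 q m ts m' (act a ts)
  | runs_step n q m ts q1 m1 a m' ts' :
      ctrl_step q m (heads ts) = (Some q1, m1, a) ->
      runs n q1 m1 (act a ts) m' ts' ->
      runs n.+1 q m ts m' ts'.

(** The top of the stack is under the head.  Blanks may surround the contents,
    because popping leaves blanks on the left and reading beyond the end of the
    tape creates some on the right. *)
Definition holds_stack (s : seq S) (t : tape (option S)) : Prop :=
  exists a b, t = Tape (nseq a None) (map Some s ++ nseq b None).

Definition holds (st : store) (ts : tapes) : Prop :=
  size st = k.+1 /\ forall i : 'I_k.+1, holds_stack (nth [::] st i) (ts i).

(** Total correctness with a time bound: the compiled program, started on any
    tapes that hold [st], exits within [n] machine steps with memory [m'] and tapes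
    that hold [st']. *)
Definition exec (c : com) (m : memory) (st : store) (n : nat) (m' : memory)
    (st' : store) : Prop :=
  forall ts, holds st ts -> exists n' ts',
    [/\ n' <= n, runs n' (entry c) m ts m' ts' & holds st' ts'].

Lemma holds_stack_read s t : holds_stack s t -> tread None t = ohead s.
Proof. by move=> [a [b ->]]; case: s => //=; case: b. Qed.

Lemma tops_ofE st ts : holds st ts -> tops_of (heads ts) = map ohead st.
Proof.
move=> [sz h]; apply: (@eq_from_nth _ None).
  by rewrite /tops_of !size_map -?enumT size_enum_ord sz.
rewrite /tops_of size_map size_enum_ord => i ik.
rewrite (nth_map ord0) ?size_enum_ord // ffunE.
rewrite (nth_map [::]) ?sz //.
by rewrite (holds_stack_read (h _)) nth_enum_ord.
Qed.

Lemma holds_stack_stay s t :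
  holds_stack s t -> holds_stack s (tact None (tread None t, Stay) t).
Proof.
move=> [a [b ->]]; case: s => [|x s] /=; last by exists a, b.
by case: b => [|b]; [exists a, 1 | exists a, b.+1].
Qed.

Lemma holds_stack_pop s t :
  holds_stack s t -> holds_stack (behead s) (tact None (None, MoveRight) t).
Proof.
move=> [a [b ->]]; case: s => [|x s] /=; exists a.+1; last by exists b.
by exists b.-1; case: b.
Qed.

Lemma holds_stack_push x s t : holds_stack s t ->
  holds_stack (x :: s)
    (tact None (Some x, Stay) (tact None (tread None t, MoveLeft) t)).
Proof.
move=> [a [b ->]]; rewrite /tact /tread /=.
exists a.-1; case: s => [|y s] /=.
  case: b => [|b]; [exists 1 | exists b.+1]; case: a => //=.
by exists b; case: a.
Qed.

Lemma holds_idle st ts : holds st ts -> holds st (act (idle (heads ts)) ts).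
Proof.
by move=> [sz h]; split=> // i; rewrite /act !ffunE; apply: holds_stack_stay.
Qed.

Lemma exec_do f m st :
  let a := f m (map ohead st) in
  exec (Do f) m st 2 a.1 (update a.2 st).
Proof.
move=> a ts h; have [sz hs] := h.
exists 2, (act (write (heads (act (prepare (heads ts) a.2) ts)) (pushed a.2))
            (act (prepare (heads ts) a.2) ts)).
split=> //.
  apply: runs_step; first by rewrite /= (tops_ofE h) -/a.
  by apply: runs_exit.
split; first by rewrite size_mkseq.
move=> i; rewrite nth_mkseq ?sz // /act !ffunE.
case: (lookup a.2 i) => [||x] /=.
- by apply/holds_stack_stay/holds_stack_stay.
- by apply/holds_stack_stay/holds_stack_pop.
- exact: holds_stack_push.
Qed.

(** The control points of [b] are embedded in those of [Seq a b], so a run of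
    [b] is literally a run of [Seq a b]. *)
Lemma runs_seq_right a b n q m ts m' ts' :
  @runs b n q m ts m' ts' -> @runs (Seq a b) n (inr q) m ts m' ts'.
Proof.
elim=> {n q m ts m' ts'}.
- by move=> q m ts m1 ac e; apply: runs_exit; rewrite /= e.
- by move=> n q m ts q1 m1 ac m2 ts2 e _; apply: runs_step; rewrite /= e.
Qed.

Lemma runs_seq_left a b n q m ts m1 ts1 n' m' ts' :
  @runs a n q m ts m1 ts1 -> @runs b n' (entry b) m1 ts1 m' ts' ->
  @runs (Seq a b) (n + n') (inl q) m ts m' ts'.
Proof.
move=> r1 /(@runs_seq_right a) r2; elim: r1 r2 => {n q m ts m1 ts1}.
- move=> q m ts m1 ac e r2; rewrite add1n.
  by apply: runs_step r2; rewrite /= e.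
- move=> n q m ts q1 m1 ac m2 ts2 e _ IH /IH r2; rewrite addSn.
  by apply: runs_step r2; rewrite /= e.
Qed.

Lemma exec_seq a b m st n1 m1 st1 n2 m2 st2 :
  exec a m st n1 m1 st1 -> exec b m1 st1 n2 m2 st2 ->
  exec (Seq a b) m st (n1 + n2) m2 st2.
Proof.
move=> ea eb ts /ea [k1 [ts1 [le1 r1 /eb [k2 [ts2 [le2 r2 h2]]]]]].
exists (k1 + k2), ts2; split=> //; first exact: leq_add.
by apply: runs_seq_left r1 r2.
Qed.

Lemma exec_while_false (b : test) c m st :
  ~~ b m (map ohead st) -> exec (While b c) m st 1 m st.
Proof.
move=> nb ts h; exists 1, (act (idle (heads ts)) ts); split=> //.
  by apply: runs_exit; rewrite /= (tops_ofE h) (negbTE nb).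
exact: holds_idle.
Qed.

Lemma runs_while_body (b : test) c n q m ts m1 ts1 n' m' ts' :
  @runs c n q m ts m1 ts1 -> @runs (While b c) n' None m1 ts1 m' ts' ->
  @runs (While b c) (n + n') (Some q) m ts m' ts'.
Proof.
move=> r1 r2; elim: r1 r2 => {n q m ts m1 ts1}.
- move=> q m ts m1 ac e r2; rewrite add1n.
  by apply: runs_step r2; rewrite /= e.
- move=> n q m ts q1 m1 ac m2 ts2 e _ IH /IH r2; rewrite addSn.
  by apply: runs_step r2; rewrite /= e.
Qed.

Lemma exec_while_true (b : test) c m st n1 m1 st1 n2 m2 st2 :
  b m (map ohead st) ->
  exec c m st n1 m1 st1 -> exec (While b c) m1 st1 n2 m2 st2 ->
  exec (While b c) m st (1 + n1 + n2) m2 st2.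
Proof.
move=> bt ec ew ts h.
have [k1 [ts1 [le1 r1 /ew [k2 [ts2 [le2 r2 h2]]]]]] := ec _ (holds_idle h).
exists (1 + k1 + k2), ts2; split=> //.
  by rewrite leq_add // leq_add2l.
rewrite -addnA add1n; apply: runs_step (runs_while_body r1 r2).
by rewrite /= (tops_ofE h) bt.
Qed.

Lemma exec_weaken c m st n n' m' st' :
  exec c m st n m' st' -> n <= n' -> exec c m st n' m' st'.
Proof.
move=> e le ts /e [n1 [ts1 [le1 r h]]]; exists n1, ts1; split=> //.
exact: leq_trans le.
Qed.

(** Pouring one stack onto another, which reverses it, is the only loop that is
    needed besides those specific to the algorithm.  The guard [g] makes it a
    conditional: when false, the loop costs a single test. *)
Definition transfer (g : memory -> bool) (i j : nat) : com :=
  While (fun m tp => g m && nth None tp i)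
    (Do (fun m tp => (m, if nth None tp i is Some a
                         then [:: (i, Pop); (j, Push a)] else [::]))).

Definition moved (i j : nat) (st : store) : store :=
  set_nth [::] (set_nth [::] st i [::]) j
    (catrev (nth [::] st i) (nth [::] st j)).

Lemma exec_transfer (g : memory -> bool) (i j : nat) m (st : store) :
  g m -> i != j -> i < size st -> j < size st ->
  exec (transfer g i j) m st (3 * size (nth [::] st i) + 1) m (moved i j st).
Proof.
move=> gm ij; move e: (nth [::] st i) => s.
elim: s st e => [|a s IH] st e hi hj.
  have -> : moved i j st = st.
    rewrite /moved e /=; apply: (@eq_from_nth _ [::]) => [|l].
      by rewrite !size_set_nth (maxn_idPr hi) (maxn_idPr hj).
    rewrite !nth_set_nth /= nth_set_nth /=.
    by case: eqP => [->//|_]; case: eqP => [->|].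
  by apply: exec_while_false; rewrite (nth_map [::]) // e andbF.
pose st1 := update [:: (i, Pop); (j, Push a)] st.
have sz1 : size st1 = size st by rewrite size_mkseq.
have e1 l : l < size st -> nth [::] st1 l =
  if l == i then s else if l == j then a :: nth [::] st j else nth [::] st l.
  move=> ls; rewrite nth_mkseq //= eq_sym; case: eqP => [->|_].
    by rewrite e.
  by rewrite eq_sym; case: eqP => [->|].
have -> : moved i j st = moved i j st1.
  apply: (@eq_from_nth _ [::]) => [|l].
    by rewrite !size_set_nth sz1.
  rewrite !size_set_nth (maxn_idPr hi) (maxn_idPr hj) => ls.
  rewrite !nth_set_nth /= !nth_set_nth /=.
  case: eqP => [_|/eqP nl]; last first.
    by case: eqP => [//|/eqP li]; rewrite e1 // (negbTE li) (negbTE nl).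
  by rewrite e !e1 // eqxx eq_sym (negbTE ij) eqxx.
have ei : nth [::] st1 i = s by rewrite e1 // eqxx.
apply: exec_weaken.
  apply: exec_while_true; first by rewrite (nth_map [::]) // e gm.
    by apply: exec_do.
  rewrite /= (nth_map [::]) // e /=.
  by apply: (IH st1); rewrite ?sz1.
by rewrite /=; lia.
Qed.

Variables (c : com) (m0 : memory) (inj : option bool -> S) (out : memory -> bool).
Hypothesis inj_inj : injective inj.

Lemma inj_Some : injective (fun a => Some (inj a)).
Proof. by move=> a b []; apply: inj_inj. Qed.

(** The machine halts when control leaves the program, and then the memory
    alone determines its answer. *)
Definition compile : TM :=
  @MkTM k (option (ctrl c) * memory)%type (option S) None (fun a => Some (inj a))
    inj_Some (fun _ => isT) (Some (entry c), m0)
    (fun q => if q.1 is None then Some (out q.2) else None)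
    (fun q r => if q.1 is Some p then
        let a := ctrl_step p q.2 r in ((a.1.1, a.1.2), a.2)
      else (q, idle r)).

Definition initial_store (x : seq (option bool)) : store :=
  map inj x :: nseq k [::].

Lemma result_halt (T : TM) x n b t :
  result T x n = Some b -> n <= t -> result T x t = Some b.
Proof.
rewrite /result => e /subnKC <-; rewrite addnC iterD.
elim: (t - n) => //= l IH; rewrite /step.
by rewrite IH.
Qed.

Lemma runs_compile n q m ts m' ts' :
  @runs c n q m ts m' ts' ->
  cstate (iter n (@step compile)
    (@Config compile (Some q, m) ts)) = (None, m').
Proof.
elim=> {n q m ts m' ts'}.
- by move=> q m ts m' a e; rewrite /= /step /= -/(heads ts) e.
- move=> n q m ts q1 m1 a m' ts' e _; rewrite iterSr => <-.
  by congr (cstate (iter _ _ _)); rewrite /step /= -/(heads ts) e.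
Qed.

Lemma exec_result x n m st t :
  exec c m0 (initial_store x) n m st -> n <= t -> result compile x t = Some (out m).
Proof.
move=> e nt; pose ts i := Tape [::] (if i == ord0 :> 'I_k.+1
  then [seq Some (inj a) | a <- x] else [::]).
have [|n' [ts' [le r _]]] := e ts.
  split=> [|i]; first by rewrite /= size_nseq.
  exists 0, 0; rewrite cats0 /ts; congr Tape; rewrite -val_eqE /=.
  by case: i => [[|i] lt] /=; rewrite ?nth_nseq ?if_same // -map_comp.
apply: (result_halt _ (leq_trans le nt)); rewrite /result.
have -> : init compile x = @Config compile (Some (entry c), m0) ts by [].
by rewrite (runs_compile r).
Qed.

End StackPrograms.

(** * Alphabet, registers and stacks of the elimination programs *)

Section Program.

Variable F : finFieldType.

(** Stacks contain input symbols, entries of vectors, and marks that separate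
    vectors.  The tag of an entry tells whether it belongs to the first half of
    a doubled vector, and the tag of a mark on the stack of vectors whether the
    vector belongs to [P] ([true]) or to [Q] ([false]). *)
Inductive sym := In of option bool | Ent of bool & F | Mark of bool.

Definition sym_code (s : sym) : option bool + (bool * F) + bool :=
  match s with
  | In a => inl (inl a) | Ent h a => inl (inr (h, a)) | Mark t => inr t
  end.
Definition sym_decode (s : option bool + (bool * F) + bool) : sym :=
  match s with
  | inl (inl a) => In a | inl (inr (h, a)) => Ent h a | inr t => Mark t
  end.
Lemma sym_codeK : cancel sym_code sym_decode. Proof. by case. Qed.
HB.instance Definition _ := Finite.copy sym (can_type sym_codeK).

(** A [reader] is the state of the parser: the number of the field of the input
    tuple being read; within the matrix, the position inside the one-hot code
    of a scalar, zero standing for the announcing bit; and the scalar seen so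
    far.  A [selector] tells whether a column is used, and if so with which tag
    and in which of its two halves. *)
Notation reader := ('I_5 * 'I_#|F|.+1 * F)%type.
Notation selector := (option (bool * (bool * bool))).

(** [coef] is the multiple of the pivot row to subtract from the current
    vector, once known; [nz] records whether the two halves of the pivot row are
    nonzero; [found] collects whether a zero vector of [P] was met and whether
    a vector of [Q] was met whose first half only is zero; [old] keeps
    the value of [found] from an earlier elimination. *)
Record memory := Mem {
  rd : reader; flag : bool; sel : selector; coef : option F;
  nz : bool * bool; found : bool * bool; old : bool * bool }.

Definition mem_code (m : memory) :=
  (rd m, flag m, sel m, coef m, nz m, found m, old m).
Definition mem_decode x :=
  let: (r, f, s, c, n, v, o) := x in Mem r f s c n v o.
Lemma mem_codeK : cancel mem_code mem_decode. Proof. by case. Qed.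
HB.instance Definition _ := Finite.copy memory (can_type mem_codeK).

Notation op := (op sym).
Notation com := (com sym memory).
Notation exec := (@exec sym memory 10).
Notation pop i := (i, Pop sym).
Notation push i a := (i, Push a).

(** [sI] holds the input and [sJ] the part of it already read; [sW] the matrix,
    with the halves of its columns assembled via [sT]; [sU], [sX], [sY] the
    bits of the sets that follow the matrix in the input; [sL] the vectors under
    elimination and [sR] those already reduced; [sV] and [sZ] the pivot row,
    backwards and forwards. *)
Definition sI := 0. Definition sJ := 1. Definition sW := 2. Definition sT := 3.
Definition sU := 4. Definition sX := 5. Definition sY := 6. Definition sL := 7.
Definition sR := 8. Definition sV := 9. Definition sZ := 10.

Notation St i j w t u x y l r v z :=
  [:: i : seq sym; j; w; t; u; x; y; l; r; v; z].

Lemma exec_do_to (f : instr sym memory) m st m' os st' :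
  f m (map ohead st) = (m', os) -> update os st = st' ->
  exec (Do f) m st 2 m' st'.
Proof. by move=> e <-; have := @exec_do sym memory 10 f m st; rewrite /= e. Qed.

Lemma exec_transfer_to (g : memory -> bool) (i j : nat) m st n st' :
  g m -> i != j -> i < size st -> j < size st -> moved i j st = st' ->
  n = 3 * size (nth [::] st i) + 1 ->
  exec (transfer sym g i j) m st n m st'.
Proof. by move=> *; subst; apply: exec_transfer. Qed.

(** * Parsing the input *)

(** The second component of the result signals the end of a column, and the
    third lists the pushes.  Each entry is pushed on [sW] and, with the other
    tag, on [sT]: at the end of the column [sT] is poured onto [sW], so
    that the column appears there twice, the second time backwards.  The
    reversal is harmless since it is the same for all columns. *)
Definition read_symbol (r : reader) (a : option bool) :
    reader * bool * seq (nat * op) :=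
  let: (f, p, c) := r in
  if a is Some b then
    if f == 0 :> nat then
      if p == 0 :> nat then
        if b then ((f, inord 1, c), false, [::]) else (r, true, [::])
      else
        let c' := if b then nth 0%R (enum F) p.-1 else c in
        if p == #|F| :> nat then
          ((f, ord0, c'), false,
           [:: push sW (Ent true c'); push sT (Ent false c')])
        else ((f, inord p.+1, c'), false, [::])
    else if f <= 3 then (r, false, [:: push (3 + f) (In (Some b))])
    else (r, false, [::])
  else ((inord (minn 4 f.+1), ord0, 0%R), false, [::]).

Definition nonempty i : test sym memory := fun _ tp => isSome (nth None tp i).

Definition read_next : instr sym memory := fun m tp =>
  if nth None tp sI is Some (In a) then
    let x := read_symbol (rd m) a in
    (Mem x.1.1 x.1.2 (sel m) (coef m) (nz m) (found m) (old m),
     pop sI :: push sJ (In a) :: x.2)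
  else (m, [:: pop sI]).

Definition read_input : com :=
  While (nonempty sI)
    (Seq (Seq (Do read_next) (transfer sym flag sT sW))
      (Do (fun m _ => (m, if flag m then [:: push sW (Mark true)] else [::])))).

Notation fields := (seq sym * seq sym * seq sym * seq sym * seq sym)%type.

(** The effect of reading one symbol, as a function on the contents of [sW],
    [sT], [sU], [sX] and [sY]. *)
Definition feed (s : reader * fields) (a : option bool) : reader * fields :=
  let: (r, (w, t, u, x, y)) := s in
  let: (r', e, os) := read_symbol r a in
  let w' := do_op (lookup os sW) w in
  let t' := do_op (lookup os sT) t in
  (r', (if e then Mark true :: catrev t' w' else w', if e then [::] else t',
        do_op (lookup os sU) u, do_op (lookup os sX) x, do_op (lookup os sY) y)).

Notation fed inp := (foldl feed ((ord0, ord0, 0%R),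
  ([::], [::], [::], [::], [::])) inp).

Lemma read_symbol_cases r a : exists r' e os, [/\ read_symbol r a = (r', e, os),
   (e -> os = [::]) &
   [\/ os = [::], exists c, os = [:: push sW (Ent true c); push sT (Ent false c)]
    | exists b, [\/ os = [:: push sU (In b)], os = [:: push sX (In b)] |
      os = [:: push sY (In b)] ] ] ].
Proof.
case: r => [[[f lt] p] c]; case: a => [b|]; last by do 3 eexists; split=> //; constructor.
case: f lt => [|f] lt; rewrite /read_symbol /=.
  case: (nat_of_ord p == 0).
    by case: b; do 3 eexists; split=> //; constructor.
  case: (nat_of_ord p == _); do 3 eexists; split=> //; last by constructor.
  by constructor 2; eexists.
case: f lt => [|[|[|f]]] lt /=; last by do 3 eexists; split=> //; constructor.
- by do 3 eexists; split=> //; constructor 3; exists (Some b); constructor 1.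
- by do 3 eexists; split=> //; constructor 3; exists (Some b); constructor 2.
- by do 3 eexists; split=> //; constructor 3; exists (Some b); constructor 3.
Qed.

(** Valid for arbitrary words, well-formed or not.  Every symbol adds at most
    two symbols to [sW] and [sT] together, so that pouring [sT] costs linear
    time. *)
Lemma exec_read_input inp : forall r e s c n fd o j w t u x y l rr v z,
  let: (r', (w', t', u', x', y')) := foldl feed (r, (w, t, u, x, y)) inp in
  exists e',
  exec read_input (Mem r e s c n fd o)
    (St (map In inp) j w t u x y l rr v z)
    (size inp * (8 + 3 * (size t + size inp)) + 1)
    (Mem r' e' s c n fd o)
    (St [::] (catrev (map In inp) j) w' t' u' x' y' l rr v z)
  /\ size w' + size t' <= size w + size t + 2 * size inp.
Proof.
elim: inp => [|a inp IH] r e s c n fd o j w t u x y l rr v z.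
  exists e; split; last by rewrite muln0 addn0.
  by apply: exec_weaken (exec_while_false _ _) _ => //; lia.
rewrite [foldl _ _ _]/=.
have [r1 [e1 [os [er eos hos]]]] := read_symbol_cases r a.
rewrite er.
set w0 := do_op (lookup os sW) w; set t0 := do_op (lookup os sT) t.
set u1 := do_op (lookup os sU) u; set x1 := do_op (lookup os sX) x.
set y1 := do_op (lookup os sY) y.
set w1 := (X in (X, _, u1, x1, y1)); set t1 := (X in (w1, X, u1, x1, y1)).
have hupd : update (pop sI :: push sJ (In a) :: os)
   (St (map In (a :: inp)) j w t u x y l rr v z) =
   St (map In inp) (In a :: j) w0 t0 u1 x1 y1 l rr v z.
  rewrite /w0 /t0 /u1 /x1 /y1.
  by case: hos => [->|[b ->]|[b [] ->]].
have ht0 : size w0 + size t0 <= size w + size t + 2 /\ size t0 <= size t + 1.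
  rewrite /w0 /t0; case: hos => [->|[b ->]|[b [] ->]] /=; lia.
have ht0e : e1 -> t0 = t /\ w0 = w.
  by move=> /eos eo; rewrite /t0 /w0 eo.
have := IH r1 e1 s c n fd o (In a :: j) w1 t1 u1 x1 y1 l rr v z.
case: (foldl _ _ _) => r' [[[[w' t'] u'] x'] y'] [e' [he hs]].
exists e'; split; last first.
  apply: leq_trans hs _; rewrite mulnS addnA leq_add2r.
  rewrite /w1 /t1; case: (e1) ht0e ht0 => [/(_ isT) [-> ->]|_ [] //] _.
  by rewrite /= catrevE size_cat size_rev; lia.
have t1s : size t1 <= size t + 1.
  by rewrite /t1; case: (e1) => //=; have [] := ht0.
apply: exec_weaken.
  apply: (exec_while_true _ _ he); first by [].
    apply: exec_seq (exec_seq _ _) _.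
    - apply: exec_do_to; first by rewrite /read_next /= er; reflexivity.
      exact: hupd.
    - apply: (@exec_weaken _ _ _ _ _ _ (3 * size t0 + 1) _ _
         (St (map In inp) (In a :: j) (if e1 then catrev t0 w0 else w0)
           t1 u1 x1 y1 l rr v z)) (leqnn _).
      rewrite /t1; case: (e1).
        by apply: exec_transfer_to.
      by apply: exec_weaken (exec_while_false _ _) _ => //; lia.
    - apply: exec_do_to; first by reflexivity.
      by rewrite /w1 /t1; case: (e1).
have [_] := ht0; rewrite /=; nia.
Qed.

(** * Extracting vectors from the columns *)

Definition bit_of (o : option sym) := if o is Some (In (Some b)) then b else false.

Definition scale (s : bool * bool) (h : bool) (a : F) : F :=
  if (if h then s.1 else s.2) then a else 0%R.

(** A vector is a sequence of tagged scalars; the tag [true] marks the entries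
    of its first half. *)
Notation vec := (seq (bool * F)).

Definition ent (p : bool * F) := Ent p.1 p.2.

(** The layout of tagged vectors on the stacks [sL] and [sR]. *)
Definition ser (vs : seq (bool * vec)) : seq sym :=
  flatten [seq rcons (map ent p.2) (Mark p.1) | p <- vs].

(** A column of the matrix together with the bits of the three sets. *)
Notation column := (seq F * (bool * bool * bool))%type.

Section Select.

Variable sf : bool -> bool -> bool -> selector.

Definition select_next : instr sym memory := fun m tp =>
  match nth None tp sW with
  | Some (Mark _) =>
      let s := sf (bit_of (nth None tp sU)) (bit_of (nth None tp sX))
                  (bit_of (nth None tp sY)) in
      (Mem (rd m) (flag m) s (coef m) (nz m) (found m) (old m),
       [:: pop sW; pop sU; pop sX; pop sY] ++
       (if s is Some (t, _) then [:: push sL (Mark t)] else [::]))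
  | Some (Ent h a) =>
      (m, pop sW ::
          (if sel m is Some (_, s) then [:: push sL (Ent h (scale s h a))]
           else [::]))
  | _ => (m, [:: pop sW])
  end.

Definition select : com := While (nonempty sW) (Do select_next).

(** The effect of [select]: columns lie on [w] below their mark, so the selector
    is computed at the mark and governs the entries that follow. *)
Fixpoint selection (s : selector) (w u x y l : seq sym) :=
  match w with
  | [::] => (s, u, x, y, l)
  | Mark _ :: w' =>
      let s := sf (bit_of (ohead u)) (bit_of (ohead x)) (bit_of (ohead y)) in
      selection s w' (behead u) (behead x) (behead y)
        (if s is Some (t, _) then Mark t :: l else l)
  | Ent h a :: w' => selection s w' u x y
      (if s is Some (_, s) then Ent h (scale s h a) :: l else l)
  | In _ :: w' => selection s w' u x y l
  end.

Lemma exec_select w : forall r e s c n fd o i j t u x y l rr v z,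
  let: (s', u', x', y', l') := selection s w u x y l in
  exec select (Mem r e s c n fd o) (St i j w t u x y l rr v z)
    (3 * size w + 1)
    (Mem r e s' c n fd o) (St i j [::] t u' x' y' l' rr v z).
Proof.
elim: w => [|a w IH] r e s c n fd o i j t u x y l rr v z.
  by apply: exec_weaken (exec_while_false _ _) _.
case: a => [a|h a|tg]; rewrite [selection _ _ _ _ _ _]/=.
- have := IH r e s c n fd o i j t u x y l rr v z.
  case: (selection _ _ _ _ _ _) => [[[[s' u'] x'] y'] l'] he.
  apply: exec_weaken.
    apply: (exec_while_true _ _ he); first by [].
    by apply: exec_do_to; first by reflexivity.
  by rewrite /=; lia.
- set l1 := (X in selection _ _ _ _ _ X).
  have := IH r e s c n fd o i j t u x y l1 rr v z.
  case: (selection _ _ _ _ _ _) => [[[[s' u'] x'] y'] l'] he.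
  apply: exec_weaken.
    apply: (exec_while_true _ _ he); first by [].
    apply: exec_do_to; first by reflexivity.
    by rewrite /l1; case: (s) => [[]|].
  by rewrite /=; lia.
- set s1 := sf _ _ _; set l1 := (X in selection _ _ _ _ _ X).
  have := IH r e s1 c n fd o i j t (behead u) (behead x) (behead y) l1 rr v z.
  case: (selection _ _ _ _ _ _) => [[[[s' u'] x'] y'] l'] he.
  apply: exec_weaken.
    apply: (exec_while_true _ _ he); first by [].
    apply: exec_do_to; first by reflexivity.
    by rewrite /l1 -/s1; case: (s1) => [[]|].
  by rewrite /=; lia.
Qed.

(** Malformed inputs must also be processed in polynomial time.  This holds
    because whatever lies on [sW], the result is the layout of some list of
    vectors: while a selector is active, the entries extend the vector whose
    mark was pushed last. *)
Lemma selection_ser w : forall (s : selector) u x y vs, (s -> vs != [::]) ->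
  exists s' u' x' y' vs', selection s w u x y (ser vs) = (s', u', x', y', ser vs')
    /\ size (ser vs') <= size (ser vs) + size w.
Proof.
elim: w => [|a w IH] s u x y vs svs.
  by do 5 eexists; split; [reflexivity|rewrite addn0].
have weak vs1 n : size (ser vs1) <= (size (ser vs)).+1 ->
    n <= size (ser vs1) + size w -> n <= size (ser vs) + (size w).+1.
  by move=> h1 h2; apply: leq_trans h2 _; rewrite addnS -addSn leq_add2r.
case: a => [a|h a|tg]; rewrite [selection _ _ _ _ _ _]/=.
- have [s' [u' [x' [y' [vs' [-> le]]]]]] := IH s u x y vs svs.
  by exists s', u', x', y', vs'; split=> //; apply: weak le.
- case: s svs => [[t b]|] svs.
    case: vs svs weak => [/(_ isT)//|[t1 c] vs] _ weak.
    have [s' [u' [x' [y' [vs' [e le]]]]]] :=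
      IH (Some (t, b)) u x y ((t1, (h, scale b h a) :: c) :: vs) (fun=> isT).
    by exists s', u', x', y', vs'; split; [exact: e|apply: weak le].
  have [s' [u' [x' [y' [vs' [-> le]]]]]] := IH None u x y vs svs.
  by exists s', u', x', y', vs'; split=> //; apply: weak le.
- set s1 := sf _ _ _.
  case: s1 => [[t b]|].
    have [s' [u' [x' [y' [vs' [e le]]]]]] := IH (Some (t, b)) (behead u)
      (behead x) (behead y) ((t, [::]) :: vs) (fun=> isT).
    by exists s', u', x', y', vs'; split; [exact: e|apply: weak le].
  have [|s' [u' [x' [y' [vs' [-> le]]]]]] := IH None (behead u)
      (behead x) (behead y) vs; first by [].
  by exists s', u', x', y', vs'; split=> //; apply: weak le.
Qed.

Definition doubled (c : seq F) : vec :=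
  [seq (true, a) | a <- c] ++ rev [seq (false, a) | a <- c].

Definition scaled (s : bool * bool) (c : seq F) : vec :=
  [seq (p.1, scale s p.1 p.2) | p <- doubled c].

(** The contents of [sW] after parsing; the tag of the marks on this stack
    carries no information. *)
Definition columns (cs : seq column) : seq sym :=
  flatten [seq Mark true :: map ent (rev (doubled p.1)) | p <- cs].

Definition chosen (cs : seq column) : seq (bool * vec) :=
  pmap (fun p : column => omap (fun t => (t.1, scaled t.2 p.1))
    (sf p.2.1.1 p.2.1.2 p.2.2)) cs.

(** An exhausted stack counts as an unlimited supply of zeros, which lets the
    independence test read one set where the equivalence test reads three. *)
Fixpoint provides (xs : seq sym) (bs : seq bool) :=
  if bs is b :: bs' then (bit_of (ohead xs) == b) && provides (behead xs) bs'
  else nilp xs.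

Lemma selection_entries es : forall s w u x y l,
  selection s (map ent es ++ w) u x y l = selection s w u x y
    (if s is Some (_, s) then
       catrev (map ent [seq (p.1, scale s p.1 p.2) | p <- es]) l else l).
Proof.
elim: es => [|[h a] es IH] s w u x y l; first by case: s => [[]|].
by rewrite [LHS]/= IH; case: s => [[]|].
Qed.

Lemma ser_cat us vs : ser (us ++ vs) = ser us ++ ser vs.
Proof. by rewrite /ser map_cat flatten_cat. Qed.

(** Moving the columns from [sW] to [sL] reverses them and their order, which
    undoes the reversal made by the parser. *)
Lemma selection_columns cs : forall s u x y l,
  provides u [seq p.2.1.1 | p <- cs] -> provides x [seq p.2.1.2 | p <- cs] ->
  provides y [seq p.2.2 | p <- cs] ->
  exists s', selection s (columns cs) u x y l =
    (s', [::], [::], [::], ser (chosen (rev cs)) ++ l).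
Proof.
elim: cs => [|[c [[bu bx] byy]] cs IH] s u x y l.
  by move=> /nilP -> /nilP -> /nilP ->; exists s.
move=> /= /andP[/eqP e1 h1] /andP[/eqP e2 h2] /andP[/eqP e3 h3].
rewrite e1 e2 e3 rev_cons -cats1 /chosen pmap_cat /= ser_cat -catA.
case: (sf _ _ _) => [[t b]|] /=; last first.
  by rewrite selection_entries; have [s' ->] := IH None _ _ _ l h1 h2 h3; exists s'.
rewrite selection_entries.
have [s' ->] := IH (Some (t, b)) _ _ _ (catrev [seq ent i
         | i <- [seq (p.1, scale b p.1 p.2) | p <- rev (doubled c)]]
      (Mark t :: l)) h1 h2 h3; exists s'.
congr (_, _ ++ _); rewrite catrevE !map_rev revK.
by rewrite /ser /= cats0 -cats1 -catA.
Qed.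

Definition restart : instr sym memory := fun m _ =>
  (Mem (ord0, ord0, 0%R) false None None (false, false) (found m) (old m),
   [::]).

(** The input is restored at the end, so that a program can build several
    families of vectors, one on top of the other. *)
Definition build : com :=
  Seq (Do restart) (Seq read_input (Seq select (transfer sym xpredT sJ sI))).

Lemma exec_build inp m l r v z :
  let: (r', (w', t', u', x', y')) := fed inp in
  let: (s', u1, x1, y1, l1) := selection None w' u' x' y' l in
  exists m', [/\ found m' = found m, old m' = old m &
  exec build m
    (St (map In inp) [::] [::] [::] [::] [::] [::] l r v z)
    (20 * (size inp).+1 ^ 2)
    m' (St (map In inp) [::] [::] t' u1 x1 y1 l1 r v z)] /\
  size w' <= 2 * size inp.
Proof.
have := @exec_read_input inp (ord0, ord0, 0%R) false None None (false, false)
  (found m) (old m) [::] [::] [::] [::] [::] [::] l r v z.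
case: (foldl _ _ _) => r' [[[[w' t'] u'] x'] y'] [e [he hs]].
have := @exec_select w' r' e None None (false, false) (found m) (old m)
  [::] (catrev (map In inp) [::]) t' u' x' y' l r v z.
case: (selection _ _ _ _ _ _) => [[[[s' u1] x1] y1] l1] he2.
rewrite !add0n in hs; have wi := leq_trans (leq_addr _ _) hs.
eexists; split=> //; split; last first.
- apply: exec_weaken.
    apply: exec_seq; first by apply: exec_do_to; reflexivity.
    apply: exec_seq he _; apply: exec_seq he2 _.
    apply: exec_transfer_to; try reflexivity.
    by rewrite /moved /= !catrevE !cats0 revK.
  rewrite /= catrevE cats0 size_rev size_map; nia.
- by [].
- by [].
Qed.

End Select.

(** * Elimination *)

(** Subtraction from [c] of the multiple of [v] that cancels the entry of [c] at
    the first nonzero position of [v].  Reading both vectors from the left, this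
    multiple is known as soon as it is needed, since the entries of [v] before
    the pivot are zero; hence a single pass suffices. *)
Fixpoint reduce (k : option F) (v c : vec) : vec :=
  if c is (h, a) :: c' then
    let y := (head (false, 0%R) v).2 in
    let k' := if k is Some _ then k else
              if y != 0%R then Some (a / y)%R else None in
    (h, a - odflt 0 k' * y)%R :: reduce k' (behead v) c'
  else [::].

Definition mark_nz (n : bool * bool) (p : bool * F) : bool * bool :=
  (n.1 || p.1 && (p.2 != 0%R), n.2 || ~~ p.1 && (p.2 != 0%R)).

Definition judge (fd : bool * bool) (t : bool) (n : bool * bool) :=
  if t then (fd.1 || ~~ n.1 && ~~ n.2, fd.2)
  else (fd.1, fd.2 || ~~ n.1 && n.2).

(** The argument [k] is fuel; the recursion is on a list of reduced vectors and
    so not structural. *)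
Fixpoint eliminate (k : nat) (vs : seq (bool * vec)) (fd : bool * bool) :=
  match k, vs with
  | k'.+1, (t, v) :: vs' =>
      eliminate k' [seq (p.1, reduce None v p.2) | p <- vs']
        (judge fd t (foldl mark_nz (false, false) v))
  | _, _ => fd
  end.

Definition entry_value (o : option sym) : F :=
  if o is Some (Ent _ a) then a else 0%R.

Definition load_next : instr sym memory := fun m tp =>
  if nth None tp sL is Some (Ent h a) then
    (Mem (rd m) (flag m) (sel m) (coef m) (mark_nz (nz m) (h, a)) (found m)
       (old m), [:: pop sL; push sV (Ent h a)])
  else (m, [:: pop sL]).

Definition at_entry : test sym memory := fun _ tp =>
  if nth None tp sL is Some (Ent _ _) then true else false.

Definition judge_vector : instr sym memory := fun m tp =>
  if nth None tp sL is Some (Mark t) then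
    (Mem (rd m) false (sel m) None (nz m) (judge (found m) t (nz m)) (old m),
     [:: pop sL])
  else (m, [::]).

Definition reduce_next : instr sym memory := fun m tp =>
  match nth None tp sL with
  | Some (Ent h a) =>
      let y := entry_value (nth None tp sZ) in
      let k := if coef m is Some _ then coef m else
               if y != 0%R then Some (a / y)%R else None in
      (Mem (rd m) false (sel m) k (nz m) (found m) (old m),
       [:: pop sL; push sR (Ent h (a - odflt 0 k * y)%R)] ++
       (if nth None tp sZ is Some b then [:: pop sZ; push sV b] else [::]))
  | Some (Mark t) =>
      (Mem (rd m) true (sel m) None (nz m) (found m) (old m),
       [:: pop sL; push sR (Mark t)])
  | _ => (m, [:: pop sL])
  end.

Definition reduce_all : com :=
  While (nonempty sL) (Seq (Do reduce_next) (transfer sym flag sV sZ)).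

(** Move the first vector to [sV] while inspecting it, turn it over to [sZ],
    sweep over the others, and move these back to [sL]. *)
Definition eliminate_next : com :=
  Seq (Do (fun m _ => (Mem (rd m) (flag m) (sel m) (coef m) (false, false)
                         (found m) (old m), [::])))
  (Seq (While at_entry (Do load_next))
  (Seq (Do judge_vector)
  (Seq (transfer sym xpredT sV sZ)
  (Seq reduce_all
  (Seq (transfer sym xpredT sR sL)
       (While (nonempty sZ) (Do (fun m _ => (m, [:: pop sZ]))))))))).

Definition eliminate_all : com := While (nonempty sL) eliminate_next.

Lemma exec_load c : forall r e s k n fd o i j w t u x y tg l rr v z,
  exec (While at_entry (Do load_next)) (Mem r e s k n fd o)
    (St i j w t u x y (map ent c ++ Mark tg :: l) rr v z)
    (3 * size c + 1)
    (Mem r e s k (foldl mark_nz n c) fd o)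
    (St i j w t u x y (Mark tg :: l) rr (catrev (map ent c) v) z).
Proof.
elim: c => [|[h a] c IH] r e s k n fd o i j w t u x y tg l rr v z.
  by apply: exec_weaken (exec_while_false _ _) _.
apply: exec_weaken.
  apply: (exec_while_true _ _ (IH _ _ _ _ _ _ _ _ _ _ _ _ _ _ _ _ _ _ _)).
    by [].
  by apply: exec_do_to; reflexivity.
by rewrite /=; lia.
Qed.

Lemma exec_clear z : forall m i j w t u x y l rr v,
  exec (While (nonempty sZ) (Do (fun m _ => (m, [:: pop sZ])))) m
    (St i j w t u x y l rr v z) (3 * size z + 1) m
    (St i j w t u x y l rr v [::]).
Proof.
elim: z => [|a z IH] m i j w t u x y l rr v.
  by apply: exec_weaken (exec_while_false _ _) _.
apply: exec_weaken.
  apply: (exec_while_true _ _ (IH _ _ _ _ _ _ _ _ _ _ _)); first by [].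
  by apply: exec_do_to; reflexivity.
by rewrite /=; lia.
Qed.

(** Stated in continuation style, because reducing a vector takes a number of
    iterations of the same loop that also handles the vectors after it.  The
    entries of the pivot row are split between [sZ] and [sV] during the pass and
    are reunited on [sZ] when the mark is reached. *)
Lemma exec_reduce_one c : forall r e s k n fd o i j w t u x y tg l rr v z
    K m' st',
  (exec reduce_all (Mem r true s None n fd o)
    (St i j w t u x y l
       (Mark tg :: catrev (map ent (reduce k z c)) rr) [::]
       (catrev (map ent v) (map ent z))) K m' st') ->
  exec reduce_all (Mem r e s k n fd o)
    (St i j w t u x y (map ent c ++ Mark tg :: l) rr (map ent v) (map ent z))
    ((size c).+1 * 4 + 3 * (size v + size z) + K) m' st'.
Proof.
elim: c => [|[h a] c IH] r e s k n fd o i j w t u x y tg l rr v z K m' st' he.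
  apply: exec_weaken.
    apply: (exec_while_true _ _ he); first by [].
    apply: exec_seq; first by apply: exec_do_to; reflexivity.
    by apply: exec_transfer_to; reflexivity.
  by rewrite /= size_map; lia.
case: z he => [|b z] he.
  have {}IH := IH r false s (if k is Some _ then k else None) n fd o i j w t u
    x y tg l (Ent h (a - odflt 0 (if k is Some _ then k else None) * 0)%R :: rr)
    v [::] K m' st'.
  apply: exec_weaken.
    apply: (exec_while_true _ _ (IH _)); first by [].
      apply: exec_seq.
        apply: exec_do_to; first by rewrite /reduce_next /= eqxx; reflexivity.
        by reflexivity.
      by apply: exec_while_false.
    by move: he; rewrite /= eqxx.
  by rewrite /=; lia.
set k' := if k is Some _ then k else if b.2 != 0%R then Some (a / b.2)%R else None.
have {}IH := IH r false s k' n fd o i j w t u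
    x y tg l (Ent h (a - odflt 0 k' * b.2)%R :: rr)
    (b :: v) z K m' st'.
apply: exec_weaken.
  apply: (exec_while_true _ _ (IH _)); first by [].
    apply: exec_seq.
      by apply: exec_do_to; reflexivity.
    by apply: exec_while_false.
  by move: he; rewrite /= -/k'.
by rewrite /=; lia.
Qed.

Lemma exec_reduce_all vs : forall r e s n fd o i j w t u x y rr z, exists e',
  exec reduce_all (Mem r e s None n fd o)
    (St i j w t u x y (ser vs) rr [::] (map ent z))
    (size (ser vs) * (4 + 3 * size z) + 1)
    (Mem r e' s None n fd o)
    (St i j w t u x y [::]
      (catrev (ser [seq (p.1, reduce None z p.2) | p <- vs]) rr) [::]
      (map ent z)).
Proof.
elim: vs => [|[tg c] vs IH] r e s n fd o i j w t u x y rr z.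
  by exists e; apply: exec_weaken (exec_while_false _ _) _ => //; lia.
have [e' he] := IH r true s n fd o i j w t u x y
  (Mark tg :: catrev (map ent (reduce None z c)) rr) z.
exists e'.
rewrite /ser /= -!/(ser _) -!cats1 -catA !catrev_catl.
apply: exec_weaken.
  exact: (@exec_reduce_one c r e s None n fd o i j w t u x y tg (ser vs) rr
    [::] z _ _ _ he).
rewrite !size_cat size_map /=; nia.
Qed.

Lemma size_reduce k v c : size (reduce k v c) = size c.
Proof. by elim: c k v => [|[h a] c IH] k v //=; rewrite IH. Qed.

Lemma size_ser_reduce v vs :
  size (ser [seq (p.1, reduce None v p.2) | p <- vs]) = size (ser vs).
Proof.
elim: vs => // [[t c] vs IH]; rewrite /ser /= -!/(ser _) !size_cat !size_rcons.
by rewrite !size_map size_reduce -!/(ser _) IH.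
Qed.

Lemma exec_eliminate B k : forall vs m i j w t u x y,
  size vs <= k -> size (ser vs) <= B -> exists m',
  [/\ found m' = eliminate k vs (found m), old m' = old m &
  exec eliminate_all m
    (St i j w t u x y (ser vs) [::] [::] [::])
    (k * (30 * B.+1 ^ 2) + 1) m'
    (St i j w t u x y [::] [::] [::] [::])].
Proof.
elim: k => [|k IH] vs m i j w t u x y.
  rewrite leqn0 => /nilP -> _; exists m; split=> //.
  by apply: exec_weaken (exec_while_false _ _) _.
case: vs => [|[tg v] vs] sz sB.
  exists m; split=> //.
  by apply: exec_weaken (exec_while_false _ _) _ => //; lia.
have sB' : size v + 1 + size (ser vs) <= B.
  by move: sB; rewrite /ser /= size_cat size_rcons size_map -/(ser _) addn1.
case: m => r e s c n fd o.
set n' := foldl mark_nz (false, false) v.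
have [e' he] := exec_reduce_all vs r false s n' (judge fd tg n') o
  i j w t u x y [::] v.
set vs' := [seq (p.1, reduce None v p.2) | p <- vs] in he.
have [||m' [f' o' he']] := IH vs'
  (Mem r e' s None n' (judge fd tg n') o) i j w t u x y.
- by rewrite size_map.
- by rewrite size_ser_reduce; lia.
exists m'; split=> //.
rewrite /ser /= -/(ser _) -cats1 -catA.
apply: exec_weaken.
  apply: (exec_while_true _ _ he'); first by case: (v) => [|[]].
  apply: exec_seq; first by apply: exec_do_to; reflexivity.
  apply: exec_seq; first exact: exec_load.
  apply: exec_seq; first by apply: exec_do_to; reflexivity.
  apply: exec_seq; last first.
    apply: exec_seq he _; apply: exec_seq; last exact: (@exec_clear (map ent v)).
    apply: exec_transfer_to; try reflexivity.
    by rewrite /moved /= !catrevE !cats0 revK.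
  apply: exec_transfer_to; try reflexivity.
  by rewrite /moved /= !catrevE !cats0 revK.
rewrite /= !catrevE !cats0 size_rev !size_map size_rev size_ser_reduce.
nia.
Qed.

(** * Parsing well-formed inputs *)

Definition matrix_word (cs : seq column) : seq bool :=
  flatten [seq rcons (flatten [seq true :: encode_scalar a | a <- p.1]) false
          | p <- cs].

Notation bits bs := [seq In (Some b) | b <- bs].

(** The parser is at the position of the head of [es] in the enumeration of
    the field. *)
Lemma feed_scalar_from a es : forall pre c w t u x y,
  enum F = pre ++ es -> es != [::] ->
  let d := if a \in es then a else c in
  foldl feed ((ord0, inord (size pre).+1, c), (w, t, u, x, y))
    (map Some [seq b == a | b <- es]) =
  ((ord0, ord0, d), (Ent true d :: w, Ent false d :: t, u, x, y)).
Proof.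
elim: es => // b es IH pre c w t u x y e _ /=.
have sz : size pre + (size es).+1 = #|F| by rewrite cardE e size_cat.
have pq : (size pre).+1 < #|F|.+1 by rewrite ltnS -sz addnS ltnS leq_addr.
rewrite inordK //=.
have -> : (if b == a then nth 0%R (enum F) (size pre) else c) =
          if b == a then a else c.
  by case: eqP => // <-; rewrite e nth_cat ltnn subnn.
rewrite in_cons [a == b]eq_sym.
have -> : ((size pre).+1 == #|F|) = (es == [::]).
  by rewrite -sz -[(size pre).+1]addn1 eqn_add2l eqSS eq_sym size_eq0.
case: es IH e {sz pq} => [|b' es] IH e; first by rewrite /= orbF.
rewrite [_ == [::]]/= -(size_rcons pre b).
rewrite (IH (rcons pre b)) ?cat_rcons //.
by case: (a \in _); rewrite ?orbT // orbF.
Qed.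

Lemma feed_scalar a c w t u x y :
  foldl feed ((ord0, inord 1, c), (w, t, u, x, y)) (map Some (encode_scalar a))
  = ((ord0, ord0, a), (Ent true a :: w, Ent false a :: t, u, x, y)).
Proof.
rewrite (@feed_scalar_from a (enum F) [::]) ?mem_enum //.
by apply/eqP => e; have := mem_enum F a; rewrite e.
Qed.

Lemma feed_entries cl : forall c w t u x y, exists c',
  foldl feed ((ord0, ord0, c), (w, t, u, x, y))
    (map Some (flatten [seq true :: encode_scalar a | a <- cl])) =
  ((ord0, ord0, c'),
   (catrev (map (Ent true) cl) w, catrev (map (Ent false) cl) t, u, x, y)).
Proof.
elim: cl => [|a cl IH] c w t u x y; first by exists c.
by rewrite /= map_cat foldl_cat feed_scalar.
Qed.

Lemma feed_matrix cs : forall c w u x y, exists c',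
  foldl feed ((ord0, ord0, c), (w, [::], u, x, y))
    (map Some (matrix_word cs)) =
  ((ord0, ord0, c'), (columns (rev cs) ++ w, [::], u, x, y)).
Proof.
elim: cs => [|[cl bs] cs IH] c w u x y; first by exists c.
rewrite /matrix_word /= -/(matrix_word _) map_cat foldl_cat map_rcons.
rewrite -cats1 foldl_cat; have [c' ->] := feed_entries cl c w [::] u x y.
rewrite [foldl _ _ [:: _]]/=.
set w' := (X in foldl _ (_, (X, _, _, _, _))).
have [c2 ->] := IH c' w' u x y; exists c2; congr (_, (_, _, _, _, _)).
rewrite rev_cons -cats1 /columns map_cat flatten_cat -catA; congr (_ ++ _).
rewrite /w' /= cats0 /doubled rev_cat revK map_cat map_rev -!map_comp.
by rewrite !catrevE cats0 revK catA.
Qed.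

Lemma feed_bits k bs : forall p c w t u x y, 0 < k < 5 ->
  foldl feed ((inord k, p, c), (w, t, u, x, y)) (map Some bs) =
  ((inord k, p, c), (w, t, if k == 1 then catrev (bits bs) u else u,
     if k == 2 then catrev (bits bs) x else x,
     if k == 3 then catrev (bits bs) y else y)).
Proof.
elim: bs => [|b bs IH] p c w t u x y hk; first by rewrite !if_same.
rewrite [foldl _ _ _]/= !inordK //; last by case/andP: hk.
by case: k IH hk => [|[|[|[|[|k]]]]] // IH hk; rewrite /= IH.
Qed.

Lemma feed_sep k p c fs : k < 4 ->
  foldl feed ((inord k, p, c), fs) [:: None] = ((inord k.+1, ord0, 0%R), fs).
Proof.
case: fs => [[[[w t] u] x] y] k4 /=; rewrite inordK; last by lia.
by rewrite (minn_idPr _).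
Qed.

Lemma ord0_inord : ord0 = inord 0 :> 'I_5.
Proof. by apply: val_inj; rewrite /= inordK. Qed.

Lemma provides_bits bs : provides (rev (bits bs)) (rev bs).
Proof. by rewrite -map_rev; elim: (rev bs) => //= b bs' ->; rewrite eqxx. Qed.

Lemma provides_none (T : Type) (s : seq T) : provides [::] [seq false | _ <- s].
Proof. by elim: s. Qed.

(** What parsing must leave on the stacks for [cs] to be the labelled
    matrix that a program works on. *)
Definition supplies inp (cs : seq column) := exists r u x y,
  [/\ fed inp = (r, (columns (rev cs), [::], u, x, y)),
      provides u [seq p.2.1.1 | p <- rev cs], provides x [seq p.2.1.2 | p <- rev cs] &
      provides y [seq p.2.2 | p <- rev cs]].

Lemma supplies_pair cs :
  (forall p, p \in cs -> p.2.1.2 = false /\ p.2.2 = false) ->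
  supplies (encode_tuple [:: matrix_word cs; [seq p.2.1.1 | p <- cs]]) cs.
Proof.
move=> hcs; rewrite /encode_tuple /= cats0 -!cats1 -!catA.
rewrite /supplies foldl_cat.
have [c ->] := feed_matrix cs 0%R [::] [::] [::] [::].
rewrite ord0_inord foldl_cat feed_sep //.
rewrite foldl_cat feed_bits // feed_sep // cats0.
do 4 eexists; split; first by reflexivity.
- by rewrite catrevE cats0 map_rev provides_bits.
- have -> : [seq p.2.1.2 | p <- rev cs] = [seq false | _ <- rev cs].
    by apply/eq_in_map => p; rewrite mem_rev => /hcs [].
  exact: provides_none.
- have -> : [seq p.2.2 | p <- rev cs] = [seq false | _ <- rev cs].
    by apply/eq_in_map => p; rewrite mem_rev => /hcs [].
  exact: provides_none.
Qed.

Lemma supplies_tuple cs bl :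
  supplies (encode_tuple [:: matrix_word cs; [seq p.2.1.1 | p <- cs];
     [seq p.2.1.2 | p <- cs]; [seq p.2.2 | p <- cs]; bl]) cs.
Proof.
rewrite /encode_tuple /= cats0 -!cats1 -!catA.
rewrite /supplies foldl_cat.
have [c ->] := feed_matrix cs 0%R [::] [::] [::] [::].
rewrite ord0_inord foldl_cat feed_sep //.
rewrite foldl_cat feed_bits // foldl_cat feed_sep //.
rewrite foldl_cat feed_bits // foldl_cat feed_sep //.
rewrite foldl_cat feed_bits // foldl_cat feed_sep //.
rewrite foldl_cat feed_bits // [foldl _ _ [:: _]]/= cats0.
do 4 eexists; split; first by reflexivity.
- by rewrite catrevE cats0 map_rev provides_bits.
- by rewrite catrevE cats0 map_rev provides_bits.
- by rewrite catrevE cats0 map_rev provides_bits.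
Qed.

Notation loaded inp l := (St (map In inp) [::] [::] [::] [::] [::] [::] l
  [::] [::] [::]).

Lemma exec_build_columns sf inp cs m vs : supplies inp cs ->
  exists m', [/\ found m' = found m, old m' = old m,
  exec (build sf) m (loaded inp (ser vs)) (20 * (size inp).+1 ^ 2)
    m' (loaded inp (ser (chosen sf cs ++ vs))) &
  size (ser (chosen sf cs ++ vs)) <= size (ser vs) + 2 * size inp].
Proof.
move=> [r [u [x [y [e hu hx hy]]]]].
have := exec_build sf inp m (ser vs) [::] [::] [::]; rewrite e.
have [s' ec] := selection_columns sf None (ser vs) hu hx hy.
rewrite revK -ser_cat in ec.
have [//|s1 [u1 [x1 [y1 [vs1 [ec1 hs]]]]]] :=
  @selection_ser sf (columns (rev cs)) None u x y vs.
rewrite ec => -[m' [[f o he] hw]]; exists m'; split=> //.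
have -> : ser (chosen sf cs ++ vs) = ser vs1 by move: ec1; rewrite ec => -[].
by apply: leq_trans hs _; rewrite leq_add2l.
Qed.

(** * The two machines *)

Definition pick_U (u x y : bool) : selector :=
  if u then Some (true, (false, true)) else None.

(** Selectors for the family [Q] of the inclusion test, with [x] contributing
    [(c, c)] and the complement of [u] contributing [(c, 0)], and for its family
    [P], with [y] contributing [(0, c)].  The flag [sw] exchanges the two sets,
    for the converse inclusion. *)
Definition pick_below (sw u x y : bool) : selector :=
  if (if sw then y else x) then Some (false, (true, true))
  else if u then None else Some (false, (true, false)).

Definition pick_above (sw u x y : bool) : selector :=
  if (if sw then x else y) then Some (true, (false, true)) else None.

Definition save : instr sym memory := fun m _ =>
  (Mem (rd m) (flag m) (sel m) (coef m) (nz m) (false, false) (found m), [::]).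

Definition independence_program : com := Seq (build pick_U) eliminate_all.

(** [P] is built last, so that it lies on top and is eliminated first. *)
Definition inclusion_program (sw : bool) : com :=
  Seq (build (pick_below sw)) (Seq (build (pick_above sw)) eliminate_all).

Definition equivalence_program : com :=
  Seq (inclusion_program false) (Seq (Do save) (inclusion_program true)).

Definition memory0 : memory :=
  Mem (ord0, ord0, 0%R) false None None (false, false) (false, false)
    (false, false).

Lemma In_inj : injective In. Proof. by move=> a b []. Qed.

Definition independence_machine : TM :=
  compile 10 independence_program memory0 (fun m => ~~ (found m).1) In_inj.

(** Each verdict tells whether one of the two sets is dependent, and whether
    the trace of the other is not contained in its span; the inclusions matter
    only when both sets are independent. *)
Definition verdicts_agree (v1 v2 : bool * bool) : bool :=
  (v1.1 == v2.1) && (v1.1 || ~~ v1.2 && ~~ v2.2).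

Definition equivalence_machine : TM :=
  compile 10 equivalence_program memory0 (fun m => verdicts_agree (old m) (found m))
    In_inj.

Definition verdict_of vs := eliminate (size vs) vs (false, false).

Lemma size_ser vs : size vs <= size (ser vs).
Proof.
elim: vs => //= p vs IH.
by rewrite /ser /= -/(ser _) size_cat size_rcons; lia.
Qed.

Lemma independence_machine_halts inp t : 300 * (size inp).+1 ^ 3 <= t ->
  result independence_machine inp t != None.
Proof.
move=> ht.
have := exec_build pick_U inp memory0 [::] [::] [::] [::].
case: (foldl _ _ _) => r' [[[[w' t'] u'] x'] y'].
have [//|s1 [u1 [x1 [y1 [vs [ec hs]]]]]] :=
  @selection_ser pick_U w' None u' x' y' [::].
rewrite ec => -[m' [[f o he] hw]].
have [m2 [_ _ he2]] := exec_eliminate m' (map In inp) [::] [::] t' u1 x1 y1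
  (leqnn (size vs)) (leqnn (size (ser vs))).
rewrite (exec_result (fun m => ~~ (found m).1) In_inj (exec_seq he he2)) //.
apply: leq_trans ht.
have h1 := size_ser vs.
have h2 : size (ser vs) <= 2 * size inp := leq_trans hs hw.
have h3 : size vs * (30 * (size (ser vs)).+1 ^ 2) <=
   (2 * size inp) * (30 * (2 * size inp).+1 ^ 2).
  by rewrite leq_mul ?leq_mul ?leq_exp2r //; lia.
apply: leq_trans (leq_add (leqnn _) (leq_add h3 (leqnn 1))) _.
by rewrite !expnS !expn0; nia.
Qed.

Lemma independence_machine_correct inp cs : supplies inp cs ->
  exists t, result independence_machine inp t =
    Some (~~ (verdict_of (chosen pick_U cs)).1).
Proof.
move=> hs.
have [m1 [f o he sz]] := exec_build_columns pick_U memory0 [::] hs.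
rewrite cats0 in he sz; set vs := chosen _ _ in he sz *.
have [m2 [f2 _ he2]] := exec_eliminate m1 (map In inp) [::] [::] [::] [::] [::]
  [::] (leqnn (size vs)) (leqnn (size (ser vs))).
eexists; rewrite (exec_result (fun m => ~~ (found m).1) In_inj (exec_seq he he2)) //.
by rewrite f2 f.
Qed.

Definition below_above sw cs :=
  chosen (pick_above sw) cs ++ chosen (pick_below sw) cs.

Lemma exec_inclusion sw inp cs m : supplies inp cs ->
  found m = (false, false) -> exists m',
  [/\ found m' = verdict_of (below_above sw cs), old m' = old m &
  exec (inclusion_program sw) m (loaded inp [::]) (2000 * (size inp).+1 ^ 3)
    m' (loaded inp [::])].
Proof.
move=> hs fm.
have [m1 [f o he sz]] := exec_build_columns (pick_below sw) m [::] hs.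
rewrite cats0 in he sz.
have [m2 [f1 o1 he1 sz1]] :=
  exec_build_columns (pick_above sw) m1 (chosen (pick_below sw) cs) hs.
rewrite -/(below_above sw cs) in he1 sz1; set vs := below_above _ _ in he1 sz1 *.
have [m3 [f2 o2 he2]] := exec_eliminate m2 (map In inp) [::] [::] [::] [::] [::]
  [::] (leqnn (size vs)) (leqnn (size (ser vs))).
exists m3; split; [by rewrite f2 f1 f fm|by rewrite o2 o1 o| ].
apply: exec_weaken (exec_seq he (exec_seq he1 he2)) _.
have h1 := size_ser vs.
have h2 : size (ser vs) <= 4 * size inp.
  by have : size (ser [::]) = 0 by []; lia.
have h3 : size vs * (30 * (size (ser vs)).+1 ^ 2) <=
   (4 * size inp) * (30 * (4 * size inp).+1 ^ 2).
  by rewrite leq_mul ?leq_mul ?leq_exp2r //; lia.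
apply: leq_trans (leq_add (leqnn _) (leq_add (leqnn _) (leq_add h3 (leqnn 1)))) _.
by rewrite !expnS !expn0; nia.
Qed.

Lemma equivalence_machine_correct inp cs t : supplies inp cs ->
  4002 * (size inp).+1 ^ 3 <= t ->
  result equivalence_machine inp t = Some (verdicts_agree
    (verdict_of (below_above false cs)) (verdict_of (below_above true cs))).
Proof.
move=> hs ht.
have [m1 [f1 o1 he1]] := exec_inclusion false (m := memory0) hs erefl.
pose m2 := (save m1 [::]).1.
have [m3 [f3 o3 he3]] := exec_inclusion true (m := m2) hs erefl.
have he2 : exec (Do save) m1 (loaded inp [::]) 2 m2 (loaded inp [::]).
  by apply: exec_do_to.
rewrite (exec_result (fun m => verdicts_agree (old m) (found m)) In_inj
  (exec_seq he1 (exec_seq he2 he3))) ?f3 ?o3 -?f1 //.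
by apply: leq_trans ht; have := expn_gt0 (size inp).+1 3; lia.
Qed.

End Program.

Local Open Scope ring_scope.

(** * Linear algebra of the elimination *)

Section SpanElimination.

Variables (F : fieldType) (E : vectType F).

(** The condition tested by elimination, where [K] is the space of vectors with
    zero first half. *)
Definition contained (K : {vspace E}) (P Q : seq E) : bool :=
  ((<<P>> + <<Q>>) :&: K <= <<P>>)%VS.

Lemma span_reduce (T : eqType) (v : E) (cs : seq T) (G G' : T -> E) :
  {in cs, forall c, exists k, G' c = G c - k *: v} ->
  (<[v]> + <<map G' cs>> = <[v]> + <<map G cs>>)%VS.
Proof.
elim: cs => // c cs IH h; rewrite !map_cons !span_cons !addvA.
have [k e] := h c (mem_head _ _).
have -> : (<[v]> + <[G' c]> = <[v]> + <[G c]>)%VS.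
  have vl u : v \in (<[v]> + <[u]>)%VS by rewrite memvE addvSl.
  have ul u : u \in (<[v]> + <[u]>)%VS by rewrite memvE addvSr.
  apply/eqP; rewrite eqEsubv !subv_add !addvSl -!memvE /=; apply/andP; split.
    by rewrite e rpredB ?rpredZ ?ul ?vl.
  have -> : G c = G' c + k *: v by rewrite e subrK.
  by rewrite rpredD ?rpredZ ?ul ?vl.
rewrite -!addvA ![(<[G c]> + _)%VS]addvC !addvA IH // => x xs.
by apply: h; rewrite in_cons xs orbT.
Qed.

Lemma free_reduce v (us us' : seq E) :
  size us' = size us -> (<[v]> + <<us'>> = <[v]> + <<us>>)%VS ->
  v \notin <<us'>>%VS -> free (v :: us) = free us'.
Proof.
move=> sz e hv; have <- : free (v :: us') = free us' by rewrite free_cons hv.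
by rewrite /free !span_cons -e /= sz.
Qed.

(** Elimination with a vector [v] of [P]: the reduced vectors span a space that
    avoids [v], so the component along [v] splits off on both sides. *)
Lemma contained_reduce (K : {vspace E}) v P P' Q Q' :
  (<[v]> + <<P'>> = <[v]> + <<P>>)%VS -> (<[v]> + <<Q'>> = <[v]> + <<Q>>)%VS ->
  v \in K -> v \notin (<<P'>> + <<Q'>>)%VS ->
  contained K (v :: P) Q = contained K P' Q'.
Proof.
move=> eP eQ vK hv; rewrite /contained span_cons -eP.
have eS : (<[v]> + <<P'>> + <<Q>> = <[v]> + (<<P'>> + <<Q'>>))%VS.
  rewrite -addvA [(<<P'>> + <<Q>>)%VS]addvC addvA -eQ -addvA.
  by rewrite [(<<Q'>> + <<P'>>)%VS]addvC.
rewrite eS; apply/subvP/subvP => h z.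
- rewrite memv_cap => /andP[zS zK].
  have : z \in (<[v]> + <<P'>>)%VS.
    by apply: h; rewrite memv_cap zK andbT (subvP (addvSr _ _) _ zS).
  case/memv_addP => _ /vlineP[k ->] [p pP ez].
  suff k0 : k = 0 by rewrite ez k0 scale0r add0r.
  apply: contraNeq hv => k0.
  have -> : v = k^-1 *: (z - p) by rewrite ez addrK scalerA mulVf ?scale1r.
  by rewrite rpredZ // rpredB // (subvP (addvSl _ _) _ pP).
- rewrite memv_cap => /andP[/memv_addP[_ /vlineP[k ->] [s sS ez]] zK].
  rewrite ez rpredD //.
    by rewrite (subvP (addvSl _ _)) // rpredZ // memv_line.
  rewrite (subvP (addvSr _ _)) // h // memv_cap sS.
  have -> : s = z - k *: v by rewrite ez addrC addKr.
  by rewrite rpredB // rpredZ.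
Qed.

(** Elimination with a vector [v] of [Q] outside [K]: the reduced vectors and
    [K] lie in a common hyperplane [H] that avoids [v], so a vector of [K] has no
    component along [v]. *)
Lemma contained_reduce_above (K : {vspace E}) v Q Q' (H : {vspace E}) :
  (<[v]> + <<Q'>> = <[v]> + <<Q>>)%VS ->
  (<<Q'>> <= H)%VS -> (K <= H)%VS -> v \notin H ->
  contained K [::] (v :: Q) = contained K [::] Q'.
Proof.
move=> eQ QH KH vH; rewrite /contained span_nil !add0v span_cons -eQ.
congr (_ <= _)%VS; apply/vspaceP => z; rewrite !memv_cap.
case zK: (z \in K); rewrite ?andbF // !andbT.
apply/idP/idP => [|zQ]; last by rewrite (subvP (addvSr _ _)).
case/memv_addP => _ /vlineP[k ->] [q qQ ez].
suff k0 : k = 0 by rewrite ez k0 scale0r add0r.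
apply: contraNeq vH => k0.
have -> : v = k^-1 *: (z - q) by rewrite ez addrK scalerA mulVf ?scale1r.
by rewrite rpredZ // rpredB //; [exact: (subvP KH)|exact: (subvP QH)].
Qed.

End SpanElimination.

Lemma free_map (F : fieldType) (U V : vectType F) (f : 'Hom(U, V)) (X : seq U) :
  lker f == 0%VS -> free (map f X) = free X.
Proof.
by move=> /eqP f0; rewrite /free size_map -limg_span limg_dim_eq // f0 capv0.
Qed.

Section Halves.

Variables (F : finFieldType) (m : nat).
Notation E := ('cV[F]_m * 'cV[F]_m)%type.
Notation vec := (seq (bool * F)).
Notation d := (false, 0 : F).

Definition well_tagged (v : vec) := [seq p.1 | p <- v] == nseq m true ++ nseq m false.

(** The second half of a doubled vector is stored backwards. *)
Definition gather (v : vec) : E :=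
  (\col_i (nth d v i).2, \col_i (nth d v (m + m - i.+1)%N).2).

Arguments gather : simpl never.

(** The coordinate of a pair that corresponds to position [p] of the sequence it
    was gathered from; its kernel for the pivot position is the hyperplane used
    in the elimination. *)
Definition entry_at (p : nat) (z : E) : F^o :=
  if insub p is Some i then z.1 i 0
  else if insub (m + m - p.+1)%N is Some i then z.2 i 0 else 0.

Lemma entry_at_linear p : linear (entry_at p).
Proof.
move=> a u w; rewrite /entry_at.
case: insubP => [i _ _|_]; first by rewrite !mxE.
by case: insubP => [i _ _|_]; rewrite ?mxE // scaler0 addr0.
Qed.

HB.instance Definition _ p := GRing.isLinear.Build F E F^o _ (entry_at p)
  (@entry_at_linear p).

Lemma entry_at_gather p v : (p < m + m)%N -> entry_at p (gather v) = (nth d v p).2.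
Proof.
move=> pm; rewrite /entry_at; case: insubP => [i _ <-|]; first by rewrite mxE.
rewrite -leqNgt => mp; case: insubP => [i _ e|]; last by rewrite -leqNgt; lia.
by rewrite mxE e; congr (nth _ _ _).2; lia.
Qed.

Lemma well_tagged_size v : well_tagged v -> size v = (m + m)%N.
Proof. by move/eqP/(congr1 size); rewrite size_map size_cat !size_nseq. Qed.

Lemma well_tagged_nth v p : well_tagged v -> (p < m + m)%N ->
  (nth d v p).1 = (p < m)%N.
Proof.
move=> wv pm; rewrite -(nth_map _ true) ?well_tagged_size //.
rewrite (eqP wv) nth_cat size_nseq !nth_nseq; case: ltnP => // h.
by rewrite ifT //; lia.
Qed.

Lemma well_tagged_reduce k v c : well_tagged c -> well_tagged (reduce k v c).
Proof.
rewrite /well_tagged => /eqP <-; apply/eqP.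
by elim: c k v => [|[h a] c IH] k v //=; rewrite IH.
Qed.

Definition pivot (v : vec) := find (fun p => p.2 != 0) v.

Lemma nth_reduce_some k v c i : (i < size c)%N ->
  (nth d (reduce (Some k) v c) i).2 = (nth d c i).2 - k * (nth d v i).2.
Proof.
elim: c v i => // [[h a] c] IH v [|i] /= hi; first by case: v.
by rewrite IH //; case: v => //=; rewrite nth_nil.
Qed.

Lemma nth_reduce v c : size v = size c -> exists k, forall i, (i < size c)%N ->
  (nth d (reduce None v c) i).2 = (nth d c i).2 - k * (nth d v i).2 /\
  (i = pivot v -> (nth d (reduce None v c) i).2 = 0).
Proof.
elim: v c => [|[h' y] v IH] [|[h a] c] //=; first by exists 0.
move=> [sz]; have [k hk] := IH c sz.
case: (eqVneq y 0) => [->|y0] /=.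
  exists k => -[|i] hi; last first.
    by have [h1 h2] := hk i hi; split=> // -[]; rewrite -/(pivot v); apply: h2.
  by split=> //=; rewrite !mulr0.
exists (a / y) => -[|i] hi; split=> //=; first by rewrite divfK // subrr.
by rewrite nth_reduce_some.
Qed.

Lemma gather_reduce v c : well_tagged v -> well_tagged c ->
  exists k, gather (reduce None v c) = gather c - k *: gather v.
Proof.
move=> /well_tagged_size wv /well_tagged_size wc.
have [k hk] := @nth_reduce v c (etrans wv (esym wc)); exists k.
rewrite wc in hk.
congr (_, _); apply/colP => i; rewrite !mxE; have := ltn_ord i => him.
  by have [|-> _] := hk i; first by lia.
by have [|-> _] := hk (m + m - i.+1)%N; first by lia.
Qed.

Lemma entry_at_pivot v c : well_tagged v -> well_tagged c ->
  (pivot v < m + m)%N -> entry_at (pivot v) (gather (reduce None v c)) = 0.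
Proof.
move=> /well_tagged_size wv /well_tagged_size wc pm.
have [k hk] := @nth_reduce v c (etrans wv (esym wc)).
by rewrite entry_at_gather // (hk _ _).2 // wc.
Qed.

Lemma foldl_mark_nz (v : vec) n : foldl (@mark_nz F) n v =
  (n.1 || has (fun p => p.1 && (p.2 != 0)) v,
   n.2 || has (fun p => ~~ p.1 && (p.2 != 0)) v).
Proof.
elim: v n => [|p v IH] [n1 n2] /=; first by rewrite !orbF.
by rewrite IH /= !orbA.
Qed.

Lemma mark_gather v : well_tagged v ->
  foldl (@mark_nz F) (false, false) v =
  ((gather v).1 != 0, (gather v).2 != 0).
Proof.
move=> wv; have sv := well_tagged_size wv.
rewrite foldl_mark_nz /=; congr (_, _); apply/(has_nthP d)/idP.
- move=> [i]; rewrite sv => hi /andP[]; rewrite well_tagged_nth // => im h.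
  by apply: contraNneq h => /colP/(_ (Ordinal im)); rewrite !mxE => ->.
- move=> h; have /existsP[i hi] : [exists i, (gather v).1 i 0 != 0].
    apply: contraNT h; rewrite negb_exists => /forallP h.
    by apply/eqP/colP => i; rewrite [RHS]mxE; apply/eqP; rewrite -[_ == _]negbK.
  rewrite mxE in hi; exists i; first by rewrite sv; have := ltn_ord i; lia.
  by rewrite hi well_tagged_nth ?ltn_ord //; have := ltn_ord i; lia.
- move=> [i]; rewrite sv => hi /andP[]; rewrite well_tagged_nth // -leqNgt => im h.
  have im' : (m + m - i.+1 < m)%N by lia.
  apply: contraNneq h => /colP/(_ (Ordinal im')); rewrite !mxE /= => e0.
  by apply/eqP; rewrite -[RHS]e0; congr (nth _ _ _).2; lia.
- move=> h; have /existsP[i hi] : [exists i, (gather v).2 i 0 != 0].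
    apply: contraNT h; rewrite negb_exists => /forallP h.
    by apply/eqP/colP => i; rewrite [RHS]mxE; apply/eqP; rewrite -[_ == _]negbK.
  have him := ltn_ord i.
  rewrite mxE in hi; exists (m + m - i.+1)%N; first by rewrite sv; lia.
  by rewrite hi well_tagged_nth ?andbT; lia.
Qed.

Definition fst_kernel : {vspace E} := lker (linfun (@fst 'cV[F]_m 'cV[F]_m)).

Lemma mem_fst_kernel z : (z \in fst_kernel) = (z.1 == 0).
Proof. by rewrite memv_ker lfunE. Qed.

Notation with_tag t ps := [seq (t, p) | p <- ps].

Lemma entry_below_pivot v i : (i < pivot v)%N -> (nth d v i).2 = 0.
Proof. by move=> /(before_find d) /negbFE/eqP. Qed.

Lemma pivot_bound v : well_tagged v -> gather v != 0 -> (pivot v < m + m)%N.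
Proof.
move=> wv; apply: contraNT; rewrite -leqNgt => h; apply/eqP.
congr (_, _); apply/colP => i; rewrite !mxE entry_below_pivot //;
  have := ltn_ord i; lia.
Qed.

Lemma entry_at_pivot_neq0 v : well_tagged v -> gather v != 0 ->
  entry_at (pivot v) (gather v) != 0.
Proof.
move=> wv /(pivot_bound wv) h; rewrite entry_at_gather //.
have /(nth_find d) // : has (fun p => p.2 != 0) v.
by rewrite has_find (well_tagged_size wv).
Qed.

Lemma pivot_first_half v : well_tagged v -> (gather v).1 != 0 ->
  (pivot v < m)%N.
Proof.
move=> wv; apply: contraNT; rewrite -leqNgt => h; apply/eqP/colP => i.
by rewrite !mxE entry_below_pivot //; have := ltn_ord i; lia.
Qed.

Definition kernel_at v : {vspace E} := lker (linfun (entry_at (pivot v))).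

Lemma mem_kernel_at v z : (z \in kernel_at v) = (entry_at (pivot v) z == 0).
Proof. by rewrite memv_ker lfunE. Qed.

(** Taking the first nonzero entry as pivot ensures that it lies in the first
    half unless that half is zero. *)
Lemma fst_kernel_at v : well_tagged v -> (gather v).1 != 0 ->
  (fst_kernel <= kernel_at v)%VS.
Proof.
move=> wv /(pivot_first_half wv) pm; apply/subvP => z.
rewrite mem_fst_kernel mem_kernel_at /entry_at => /eqP z1.
by rewrite insubT z1 mxE.
Qed.

Lemma span_gather_reduce v cs : well_tagged v -> all well_tagged cs ->
  (<[gather v]> + <<map gather [seq reduce None v c | c <- cs]>> =
   <[gather v]> + <<map gather cs>>)%VS.
Proof.
move=> wv /allP wcs; rewrite -map_comp; apply: span_reduce => c /wcs wc.
exact: gather_reduce.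
Qed.

Lemma span_reduce_kernel v cs : well_tagged v -> all well_tagged cs ->
  gather v != 0 ->
  (<<map gather [seq reduce None v c | c <- cs]>> <= kernel_at v)%VS.
Proof.
move=> wv /allP wcs v0; apply/span_subvP => _ /mapP[_ /mapP[c cc ->] ->].
by rewrite mem_kernel_at entry_at_pivot ?pivot_bound ?eqxx // wcs.
Qed.

Lemma all_well_tagged_reduce v cs : all well_tagged cs ->
  all well_tagged [seq reduce None v c | c <- cs].
Proof. by rewrite all_map; apply: sub_all => c /= /well_tagged_reduce. Qed.

Lemma gather_reduce0 v cs : well_tagged v -> all well_tagged cs ->
  gather v = 0 -> map gather [seq reduce None v c | c <- cs] = map gather cs.
Proof.
move=> wv /allP wcs v0; rewrite -map_comp; apply/eq_in_map => c /wcs wc /=.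
by have [k ->] := gather_reduce wv wc; rewrite v0 scaler0 subr0.
Qed.

Lemma pair_eq0 (z : E) : (z == 0) = (z.1 == 0) && (z.2 == 0).
Proof. by case: z. Qed.

(** By induction on the number of vectors: each step replaces the lists by
    their reductions, which changes neither condition unless the pivot row
    itself decides one of them. *)
Lemma eliminate_flags k : forall P Q fd, (size P + size Q <= k)%N ->
  all well_tagged P -> all well_tagged Q ->
  (forall p, p \in P -> (gather p).1 = 0) ->
  eliminate k (with_tag true P ++ with_tag false Q) fd =
  (fd.1 || ~~ free (map gather P),
   fd.2 || ~~ contained (fst_kernel) (map gather P) (map gather Q)).
Proof.
elim: k => [|k IH] P Q [dep bad].
  rewrite leqn0 addn_eq0 => /andP[/nilP -> /nilP ->] _ _ _ /=.
  by rewrite nil_free /contained span_nil addv0 capvSl !orbF.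
case: P => [|v P].
  case: Q => [|v Q].
    by rewrite /= nil_free /contained span_nil addv0 capvSl !orbF.
  rewrite add0n ltnS => sz _ /andP[wv wQ] _.
  rewrite /=.
  rewrite -map_comp -[map _ Q]cat0s.
  have -> : [seq ((fun p : bool * vec => (p.1, reduce None v p.2)) \o pair false) i
              | i <- Q] =
    with_tag true [::] ++ with_tag false [seq reduce None v c | c <- Q].
    by rewrite /= -map_comp.
  rewrite IH ?size_map ?all_well_tagged_reduce //= mark_gather //=.
  rewrite nil_free orbF; congr (_, _); rewrite -orbA; congr (_ || _).
  have [g1|g1] /= := eqVneq (gather v).1 0; last first.
    rewrite -(@contained_reduce_above _ _ _ (gather v) (map gather Q) _ (kernel_at v)) //.
    - exact: span_gather_reduce.
    - by rewrite span_reduce_kernel // pair_eq0 negb_and g1.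
    - exact: fst_kernel_at.
    - by rewrite mem_kernel_at entry_at_pivot_neq0 // pair_eq0 negb_and g1.
  have [g2|g2] /= := eqVneq (gather v).2 0.
    have v0 : gather v = 0 by apply/eqP; rewrite pair_eq0 g1 g2 !eqxx.
    by rewrite gather_reduce0 // v0 /contained span_cons add0v.
  apply/esym/negP => /subvP /(_ (gather v)).
  rewrite memv_cap mem_fst_kernel g1 eqxx andbT span_nil add0v memv0 pair_eq0 g1 eqxx.
  rewrite (negbTE g2) span_cons => h; suff: false by [].
  by apply: h; rewrite (subvP (addvSl _ _)) // memv_line.
rewrite addSn ltnS => sz wvP wQ hP; have /andP[wv wP] := wvP.
rewrite /= map_cat -!map_comp.
have -> : [seq ((fun p : bool * vec => (p.1, reduce None v p.2)) \o pair true) i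
            | i <- P] ++
   [seq ((fun p : bool * vec => (p.1, reduce None v p.2)) \o pair false) i
            | i <- Q] =
  with_tag true [seq reduce None v c | c <- P] ++
  with_tag false [seq reduce None v c | c <- Q].
  by rewrite -!map_comp.
have gv1 : (gather v).1 = 0 by rewrite hP ?mem_head.
have hP' p : p \in P -> (gather p).1 = 0.
  by move=> pP; rewrite hP // in_cons pP orbT.
rewrite IH ?size_map ?all_well_tagged_reduce //; last first.
  move=> _ /mapP[p pP ->]; have [k' ->] := gather_reduce wv (allP wP p pP).
  by rewrite -[LHS]/((gather p).1 - k' *: (gather v).1) hP' // gv1 scaler0 subr0.
rewrite mark_gather // gv1 eqxx /= negbK -orbA.
have [g2|g2] /= := eqVneq (gather v).2 0.
  have v0 : gather v = 0 by apply/eqP; rewrite pair_eq0 gv1 g2 !eqxx.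
  rewrite !gather_reduce0 // v0 free_cons mem0v /=.
  by rewrite /contained span_cons -[<[0]>%VS]/(0%VS) add0v.
have v0 : gather v != 0 by rewrite pair_eq0 negb_and g2 orbT.
have nv : gather v \notin (<<map gather [seq reduce None v c | c <- P]>> +
    <<map gather [seq reduce None v c | c <- Q]>>)%VS.
  have := entry_at_pivot_neq0 wv v0; rewrite -mem_kernel_at.
  by apply: contra; apply/subvP; rewrite subv_add !span_reduce_kernel.
congr (_ || ~~ _, _ || ~~ _).
  apply/esym/free_reduce; first by rewrite !size_map.
    exact: span_gather_reduce.
  by apply: contra nv; apply/subvP/addvSl.
apply/esym/contained_reduce => //; try exact: span_gather_reduce.
by rewrite mem_fst_kernel gv1.
Qed.

End Halves.

(** * Traces of independent sets *)

Section Pairs.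

Variables (F : fieldType) (V : vectType F).

Definition diagonal (v : V) : V * V := (v, v).
Definition on_first (v : V) : V * V := (v, 0).
Definition on_second (v : V) : V * V := (0, v).

Lemma diagonal_linear : linear diagonal. Proof. by []. Qed.
Lemma on_first_linear : linear on_first.
Proof. by move=> a u v; apply: (congr2 pair) => //=; rewrite scaler0 addr0. Qed.
Lemma on_second_linear : linear on_second.
Proof. by move=> a u v; apply: (congr2 pair) => //=; rewrite scaler0 addr0. Qed.

HB.instance Definition _ := GRing.isLinear.Build F V (V * V)%type _ diagonal
  diagonal_linear.
HB.instance Definition _ := GRing.isLinear.Build F V (V * V)%type _ on_first
  on_first_linear.
HB.instance Definition _ := GRing.isLinear.Build F V (V * V)%type _ on_second
  on_second_linear.

Lemma map_linfun (U : vectType F) (f : {linear V -> U}) (X : seq V) :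
  map (linfun f) X = map f X.
Proof. by apply: eq_map => v; rewrite lfunE. Qed.

End Pairs.

Lemma enum_ranks (T : finType) :
  [seq enum_rank x | x <- enum T] = enum 'I_#|T|.
Proof.
have sz : size [seq enum_rank x | x <- enum T] = #|T| by rewrite size_map -cardE.
case: (pickP T) => [x0 _|/eq_card0 T0]; last first.
  transitivity (Nil 'I_#|T|); first by apply: size0nil; rewrite sz.
  by apply/esym/size0nil; rewrite size_enum_ord.
apply: (@eq_from_nth _ (enum_rank x0)); rewrite sz ?size_enum_ord // => i hi.
rewrite (nth_map x0) -?cardE // -[i]/(val (Ordinal hi)) nth_ord_enum.
by rewrite -(enum_val_nth x0) enum_valK.
Qed.

Section Represented.

Variables (F : finFieldType) (M : matroid) (m : nat) (A : 'M[F]_(m, #|M|)).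
Hypothesis repA : represents A.

Notation vect := 'cV[F]_m.
Implicit Types (e : M) (U X Y Z : {set M}).

Definition column_of (e : M) : vect := col (enum_rank e) A.

Definition span_of (X : {set M}) : {vspace vect} :=
  <<[seq column_of e | e <- enum X]>>%VS.

Lemma indepE X : indep X = free [seq column_of e | e <- enum X].
Proof. exact: repA. Qed.

Lemma mem_span_of e X : e \in X -> column_of e \in span_of X.
Proof. by move=> eX; rewrite memv_span // map_f // mem_enum. Qed.

Lemma span_ofS X Y : X \subset Y -> (span_of X <= span_of Y)%VS.
Proof.
move=> /subsetP XY; apply/span_subvP => v /mapP[e]; rewrite mem_enum => eX ->.
exact/mem_span_of/XY.
Qed.

Lemma span_ofU X Y : span_of (X :|: Y) = (span_of X + span_of Y)%VS.
Proof.
rewrite /span_of -span_cat -map_cat; apply: eq_span => v.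
apply/mapP/mapP => -[e he ->]; exists e => //; move: he;
  by rewrite mem_cat !mem_enum in_setU.
Qed.

Lemma indepU X Y : [disjoint X & Y] ->
  indep (X :|: Y) = [&& indep X, indep Y & (span_of X :&: span_of Y == 0)%VS].
Proof.
move=> dXY; rewrite !indepE.
have pe : perm_eq (enum (X :|: Y)) (enum X ++ enum Y).
  apply: uniq_perm => [||e]; first exact: enum_uniq.
    rewrite cat_uniq !enum_uniq /= andbT; apply/hasPn => e; rewrite !mem_enum.
    by apply: contraL => eX; rewrite (disjointFr dXY).
  by rewrite mem_cat !mem_enum in_setU.
rewrite (perm_free (perm_map _ pe)) map_cat cat_free.
by congr [&& _, _ & _]; apply/directv_addP/eqP.
Qed.

(** A largest independent subset [I] of [X] spans, since a column outside the
    span of [I] could be added to [I]. *)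
Lemma rank_dim X : rank X = \dim (span_of X).
Proof.
apply/eqP; rewrite eqn_leq; apply/andP; split.
  apply/bigmax_leqP => I /andP[IX indI].
  apply: leq_trans (dimvS (span_ofS IX)).
  by move: indI; rewrite indepE /free => /eqP ->; rewrite size_map -cardE.
have [|I] := @eq_bigmax_cond _ [pred I : {set M} | (I \subset X) && indep I]
  (fun I => #|I|).
  by apply/card_gt0P; exists set0; rewrite inE sub0set indep_set0.
rewrite inE => /andP[IX indI] rI; rewrite [rank X]rI.
have -> : span_of X = span_of I.
  apply/eqP; rewrite eqEsubv [X in _ && X]span_ofS // andbT.
  apply/span_subvP => w /mapP[e]; rewrite mem_enum => eX ->.
  case: (boolP (e \in I)) => eI; first exact: mem_span_of.
  apply/negPn/negP => ne.
  have : (#|e |: I| <= #|I|)%N.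
    rewrite -rI; apply: (@leq_bigmax_cond _ _ (fun I : {set M} => #|I|)).
    rewrite inE subUset sub1set eX IX setUC indepU ?indI; last first.
      by rewrite disjoint_sym disjoints1.
    rewrite indepE enum_set1 /= seq1_free.
    have e0 : column_of e != 0 by apply: contraNneq ne => ->; apply: mem0v.
    rewrite e0 -subv0; apply/subvP => v; rewrite memv_cap => /andP[vI].
    rewrite /span_of enum_set1 span_seq1 => /vlineP[k ev].
    suff k0 : k = 0 by rewrite ev k0 scale0r mem0v.
    apply: contraNeq ne => k0.
    have -> : column_of e = k^-1 *: v by rewrite ev scalerA mulVf ?scale1r.
    by rewrite rpredZ.
  by rewrite cardsU1 eI add1n ltnn.
by move: indI; rewrite indepE /free => /eqP ->; rewrite size_map -cardE.
Qed.

Definition interface (U : {set M}) : {vspace vect} :=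
  (span_of U :&: span_of (~: U))%VS.

(** The dimension formula for sums and intersections. *)
Lemma connectivity_dim U : connectivity U = \dim (interface U).
Proof.
rewrite /connectivity !rank_dim -(setUCr U) span_ofU.
by rewrite -(dimv_sum_cap (span_of U)) addKn.
Qed.

Definition boundary_trace (U X : {set M}) : option {set vect} :=
  if indep X then Some [set v | v \in (span_of X :&: span_of (~: U))%VS]
  else None.

Definition same_traces (U : {set M}) : rel {set M} :=
  fun X X' => boundary_trace U X == boundary_trace U X'.

Lemma boundary_trace_indep U X X' Z : X \subset U -> X' \subset U -> Z \subset ~: U ->
  same_traces U X X' -> indep (X :|: Z) -> indep (X' :|: Z).
Proof.
move=> XU X'U ZU.
have dis Y : Y \subset U -> [disjoint Y & Z].
  move=> YU; rewrite -setI_eq0 -subset0 -(setICr U); exact: setISS.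
rewrite !indepU ?dis // /same_traces /boundary_trace.
case: (indep X) => //; case: (indep X') => // /eqP [tr] /= /andP[-> /=].
rewrite -!subv0 => /subvP h; apply/subvP => v; rewrite memv_cap => /andP[vX' vZ].
apply: h; rewrite memv_cap vZ andbT.
have vU : v \in span_of (~: U) by apply: (subvP (span_ofS ZU)).
by move/setP/(_ v): tr; rewrite !inE !memv_cap vU vX' !andbT.
Qed.

Lemma same_traces_sim U X X' : X \subset U -> X' \subset U ->
  same_traces U X X' -> sim U X X'.
Proof.
move=> XU X'U h Z ZU; apply/idP/idP; apply: boundary_trace_indep ZU _ => //.
by rewrite /same_traces eq_sym.
Qed.

Lemma same_traces_equivalence U :
  {in powerset U & &, equivalence_rel (same_traces U)}.
Proof.
move=> X Y Z _ _ _; rewrite /same_traces; split=> [|/eqP ->] //.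
Qed.

Lemma card_interface U lambda : (connectivity U <= lambda)%N ->
  (#|[set v in interface U]| <= #|F| ^ lambda)%N.
Proof.
rewrite connectivity_dim cardsE => h.
have -> : #|interface U| = (#|F| ^ \dim (interface U))%N.
  exact: (@card_vspace F vect _ (interface U)).
by rewrite leq_exp2l // finNzRing_gt1.
Qed.

(** The classes correspond to values of the trace, which are subsets of the
    interface, or [None]. *)
Lemma card_classes U lambda : (connectivity U <= lambda)%N ->
  (#|equivalence_partition (same_traces U) (powerset U)|
     <= (2 ^ (#|F| ^ lambda)).+1)%N.
Proof.
move=> h; set B := [set v in interface U].
have -> : equivalence_partition (same_traces U) (powerset U) =
  [set [set Y in powerset U | t == boundary_trace U Y]
     | t in boundary_trace U @: powerset U].
  by rewrite -imset_comp; apply: eq_imset.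
apply: leq_trans (leq_imset_card _ _) _.
have sub : boundary_trace U @: powerset U \subset None |: [set Some S | S in powerset B].
  apply/subsetP => t /imsetP[X]; rewrite powersetE => XU ->.
  rewrite /boundary_trace; case: (indep X); last by rewrite setU11.
  rewrite setU1r // imset_f // powersetE; apply/subsetP => v.
  rewrite !inE !memv_cap => /andP[vX ->]; rewrite andbT.
  exact: (subvP (span_ofS XU)).
apply: leq_trans (subset_leq_card sub) _.
rewrite cardsU1 -[X in (_ <= X)%N]add1n leq_add ?leq_b1 //.
apply: leq_trans (leq_imset_card _ _) _.
by rewrite card_powerset leq_exp2l // (card_interface h).
Qed.

(** * The verdicts of the machines *)

(** A vector of the span of [Q] and [P] is [(w + s, s + p)] with [s] in
    [span_of X], [w] in the span of the complement of [U] and [p] in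
    [span_of X'].  Its first half vanishes iff [s = - w], and then it lies in the
    span of [P] iff [s] lies in [span_of X']. *)
Lemma contained_span U X X' : X \subset U ->
  contained (fst_kernel F m)
    [seq on_second (column_of e) | e <- enum X']
    [seq if e \in X then diagonal (column_of e) else on_first (column_of e)
       | e <- enum M & (e \in X) || (e \notin U)] =
  (span_of X :&: span_of (~: U) <= span_of X')%VS.
Proof.
move=> XU; rewrite /contained; set Q := (X in (_ + <<X>>)%VS).
have -> : <<[seq on_second (column_of e) | e <- enum X']>>%VS =
    (linfun (@on_second _ vect) @: span_of X')%VS.
  by rewrite limg_span map_linfun -map_comp.
have -> : <<Q>>%VS = (linfun (@diagonal _ vect) @: span_of X +
                      linfun (@on_first _ vect) @: span_of (~: U))%VS.
  rewrite !limg_span !map_linfun -span_cat -!map_comp; apply: eq_span => z.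
  rewrite mem_cat; apply/mapP/orP => [[e]|[] /mapP[e]].
  - rewrite mem_filter => /andP[]; case: ifP => eX /= eU _ ->.
      by left; apply/mapP; exists e; rewrite ?mem_enum.
    by right; apply/mapP; exists e; rewrite ?mem_enum ?in_setC.
  - rewrite mem_enum => eX ->; exists e; last by rewrite eX.
    by rewrite mem_filter eX mem_enum.
  - rewrite mem_enum in_setC => eU ->; exists e.
      by rewrite mem_filter eU orbT mem_enum.
    by case: ifP => // /(subsetP XU); rewrite (negbTE eU).
apply/subvP/subvP => h.
- move=> s; rewrite memv_cap => /andP[sX sV].
  have : (0, s) \in (linfun (@on_second _ vect) @: span_of X')%VS.
    apply: h; rewrite memv_cap mem_fst_kernel eqxx andbT.
    apply: (subvP (addvSr _ _)).
    have -> : (0, s) = linfun (@diagonal _ vect) s + linfun (@on_first _ vect) (- s).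
      by rewrite !lfunE /=; apply: (congr2 pair) => /=; rewrite ?subrr ?addr0.
    by apply: memv_add; apply: memv_img; rewrite ?rpredN.
  by case/memv_imgP => p pX'; rewrite lfunE => -[->].
- move=> z; rewrite memv_cap mem_fst_kernel => /andP[].
  case/memv_addP => _ /memv_imgP[p pX' ->] [q].
  case/memv_addP => _ /memv_imgP[s sX ->] [_ /memv_imgP[w wV ->] ->] ->.
  rewrite !lfunE /= add0r addr_eq0 => /eqP sw.
  have sX' : s \in span_of X' by apply: h; rewrite memv_cap sX sw rpredN.
  apply/memv_imgP; exists (p + s); first exact: rpredD.
  rewrite lfunE; apply: (congr2 pair) => /=; first by rewrite add0r sw addNr.
  by rewrite addr0.
Qed.

Definition entries_of (e : M) : seq F := [seq A i (enum_rank e) | i <- enum 'I_m].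

Definition labelled (U X X' : {set M}) :=
  [seq (entries_of e, (e \in U, e \in X, e \in X')) | e <- enum M].

Lemma size_entries e : size (entries_of e) = m.
Proof. by rewrite size_map size_enum_ord. Qed.

Lemma nth_entries e (i : 'I_m) : nth 0 (entries_of e) i = column_of e i 0.
Proof. by rewrite (nth_map i) ?size_enum_ord // nth_ord_enum mxE. Qed.

Lemma well_tagged_scaled s e : well_tagged m (scaled s (entries_of e)).
Proof.
have := size_entries e; move: (entries_of e) => l sl.
rewrite /well_tagged /scaled /doubled -map_comp map_cat map_rev -!map_comp /=.
have cst b : [seq b | _ <- l] = nseq m b.
  by rewrite -sl; elim: (l) => //= a l' ->.
by rewrite -[map _ l]/[seq true | _ <- l] -[X in rev X]/[seq false | _ <- l]
  !cst rev_nseq.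
Qed.

Lemma gather_scaled s e : gather m (scaled s (entries_of e)) =
  (if s.1 then column_of e else 0, if s.2 then column_of e else 0).
Proof.
have sz : size (doubled (entries_of e)) = (m + m)%N.
  by rewrite /doubled size_cat size_rev 2![size (map _ _)]size_map size_entries.
apply: (congr2 pair); apply/colP => i; rewrite mxE; have him := ltn_ord i.
- rewrite (nth_map (false, 0)) ?sz; last by lia.
  rewrite nth_cat size_map size_entries him (nth_map 0) ?size_entries //=.
  by rewrite nth_entries /scale /=; case: s.1; rewrite ?mxE.
- rewrite (nth_map (false, 0)) ?sz; last by lia.
  rewrite nth_cat size_map size_entries ifN; last by rewrite -leqNgt; lia.
  rewrite nth_rev size_map size_entries; last by lia.
  rewrite (nth_map 0) ?size_entries; last by lia.
  have -> : (m - (m + m - i.+1 - m).+1 = i)%N by lia.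
  by rewrite nth_entries /scale /=; case: s.2; rewrite ?mxE.
Qed.

Lemma chosen_labelled U X X' (sf : bool -> bool -> bool -> _) (p : pred M)
    (g : M -> bool * seq (bool * F)) :
  (forall e, omap (fun t : bool * (bool * bool) => (t.1, scaled t.2 (entries_of e)))
     (sf (e \in U) (e \in X) (e \in X')) = if p e then Some (g e) else None) ->
  chosen sf (labelled U X X') = [seq g e | e <- enum M & p e].
Proof.
move=> h; rewrite /labelled /chosen; elim: (enum M) => //= e s ->.
by rewrite h; case: (p e).
Qed.

Lemma enum_filter X : [seq e <- enum M | e \in X] = enum X.
Proof. by rewrite {2}/enum_mem -enumT. Qed.

Lemma verdict_test U X X' :
  verdict_of (chosen pick_U (labelled U X X')) = (~~ indep U, false).
Proof.
pose g e := scaled (false, true) (entries_of e).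
rewrite (chosen_labelled (p := [in U]) (g := fun e => (true, g e))); last first.
  by move=> e; rewrite /pick_U; case: (e \in U).
rewrite /verdict_of (map_comp (pair true) g) -[map _ _]cats0.
rewrite (@eliminate_flags F m _ _ [::]) //; last 3 first.
- by rewrite cats0 !size_map addn0.
- by rewrite all_map; apply/allP => e _; apply: well_tagged_scaled.
- by move=> _ /mapP[e _ ->]; rewrite gather_scaled.
rewrite /contained span_nil addv0 capvSl /=; congr (~~ _, _).
rewrite indepE -enum_filter -map_comp.
have <- := free_map (f := linfun (@on_second _ vect)).
  by rewrite map_linfun -map_comp; congr free; apply: eq_map => e /=; rewrite gather_scaled.
rewrite -subv0; apply/subvP => v; rewrite memv_ker lfunE memv0 pair_eq0.
by case/andP.
Qed.

Lemma verdict_below_above sw U X X' : X \subset U -> X' \subset U ->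
  let Y := if sw then X' else X in let Y' := if sw then X else X' in
  verdict_of (below_above sw (labelled U X X')) =
  (~~ indep Y', ~~ (span_of Y :&: span_of (~: U) <= span_of Y')%VS).
Proof.
move=> XU X'U Y Y'.
have YU : Y \subset U by rewrite /Y; case: (sw).
pose g e := scaled (false, true) (entries_of e).
pose h e := scaled (true, e \in Y) (entries_of e).
rewrite /below_above.
rewrite (chosen_labelled (p := [in Y']) (g := fun e => (true, g e))); last first.
  by move=> e; rewrite /pick_above /Y' -/(g e); case: (sw) => /=; case: (e \in _).
rewrite (chosen_labelled (p := fun e => (e \in Y) || (e \notin U))
  (g := fun e => (false, h e))); last first.
  move=> e; rewrite /pick_below /h.
  have -> : (if sw then e \in X' else e \in X) = (e \in Y) by rewrite /Y; case: (sw).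
  by case: (e \in Y) => //=; case: (e \in U).
rewrite /verdict_of (map_comp (pair true) g) (map_comp (pair false) h).
rewrite (@eliminate_flags F m) //; last 4 first.
- by rewrite size_cat !size_map.
- by rewrite all_map; apply/allP => e _; apply: well_tagged_scaled.
- by rewrite all_map; apply/allP => e _; apply: well_tagged_scaled.
- by move=> _ /mapP[e _ ->]; rewrite gather_scaled.
rewrite /= -!map_comp -(contained_span _ YU) enum_filter.
have gE : map (gather m \o g) (enum Y') = [seq on_second (column_of e) | e <- enum Y'].
  by apply: eq_map => e /=; rewrite gather_scaled.
congr (~~ _, ~~ _).
  rewrite indepE gE (map_comp (@on_second _ vect)) -map_linfun free_map //.
  rewrite -subv0; apply/subvP => v; rewrite memv_ker lfunE memv0 pair_eq0.
  by case/andP.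
rewrite gE; congr (contained _ _ _); apply: eq_map => e /=.
by rewrite gather_scaled /=; case: (e \in Y).
Qed.

Lemma verdicts_agree_traces U X X' : X \subset U -> X' \subset U ->
  verdicts_agree (verdict_of (below_above false (labelled U X X')))
    (verdict_of (below_above true (labelled U X X'))) = same_traces U X X'.
Proof.
move=> XU X'U; rewrite !verdict_below_above // /verdicts_agree /same_traces /boundary_trace /=.
case: (indep X); case: (indep X') => //=; rewrite !negbK.
apply/andP/eqP => [[h h']|[/setP h]].
  congr Some; apply/setP => v; rewrite !inE !memv_cap.
  case vU: (v \in span_of (~: U)); rewrite ?andbF // !andbT.
  by apply/idP/idP => vX; [apply: (subvP h)|apply: (subvP h')];
    rewrite memv_cap vX vU.
by split; apply/subvP => v vX; have := h v; rewrite !inE vX !memv_cap;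
  [move/esym|]; case/andP.
Qed.

Lemma encode_matrix_labelled U X X' :
  encode_matrix A = matrix_word (labelled U X X').
Proof.
rewrite /encode_matrix /matrix_word -enum_ranks /labelled -!map_comp.
by congr flatten; apply: eq_map => e /=; rewrite /entries_of -map_comp.
Qed.

Lemma supplies_independence X :
  supplies (encode_tuple [:: encode_matrix A; encode_set X])
    (labelled X set0 set0).
Proof.
rewrite (encode_matrix_labelled X set0 set0).
have -> : encode_set X = [seq p.2.1.1 | p <- labelled X set0 set0].
  by rewrite -map_comp.
by apply: supplies_pair => _ /mapP[e _ ->]; rewrite !inE.
Qed.

Lemma supplies_equivalence U X X' bl :
  supplies (encode_tuple [:: encode_matrix A; encode_set U; encode_set X;
    encode_set X'; bl]) (labelled U X X').
Proof.
rewrite (encode_matrix_labelled U X X').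
have -> : encode_set U = [seq p.2.1.1 | p <- labelled U X X'] by rewrite -map_comp.
have -> : encode_set X = [seq p.2.1.2 | p <- labelled U X X'] by rewrite -map_comp.
have -> : encode_set X' = [seq p.2.2 | p <- labelled U X X'] by rewrite -map_comp.
exact: supplies_tuple.
Qed.

End Represented.

(** * The theorem *)

(** Crude, but the bound on the number of classes may depend on [n] at will. *)
Lemma size_encode_nat n : (size (encode_nat n) <= n)%N.
Proof.
rewrite /encode_nat; case e: (bin_of_nat n) => [|p] //.
have -> : n = nat_of_pos p by rewrite -(bin_of_natK n) e.
elim: p {e} => //= p IH; rewrite !NatTrec.doubleE -addnn; have := IH; lia.
Qed.

Lemma size_encode_set (T : finType) (X : {set T}) : size (encode_set X) = #|T|.
Proof. by rewrite size_map -cardE. Qed.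

Lemma size_encode_tuple ss :
  size (encode_tuple ss) = (sumn [seq (size s).+1 | s <- ss])%N.
Proof.
rewrite /encode_tuple size_flatten /shape -map_comp; congr sumn.
by apply: eq_map => s; rewrite /= size_rcons size_map.
Qed.

Theorem theorem5p1 (F : finFieldType) (Delta : matroid -> seq bool -> Prop)
    (hDelta : matrix_representation F Delta) :
  efficiently_pigeonhole (representable F) Delta.
Proof.
have [hex hmat [K0 [d0 hsize]]] := hDelta.
split.
  split; first exact: hex.
  exists (independence_machine F); split.
    by exists 300, 3 => x; apply: independence_machine_halts.
  move=> M w X hM hw; have [m [A [repA ->]]] := hmat M w hM hw.
  have [t ht] := independence_machine_correct (supplies_independence A X).
  by exists t; rewrite ht (verdict_test repA) negbK.
pose q := #|F|.
(* The factor [l.+1 ^ 3] pays for reading the encoding of [l], in cubic time. *)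
exists (equivalence_machine F), (3 * d0.+1)%N,
  (fun l => (l.+1 ^ 3 * (2 ^ (q ^ l)).+1)%N); split.
  by move=> l _; rewrite muln_gt0 expn_gt0.
(* The input has length at most [(K0 + 10) * (l.+1 * #|M|.+1 ^ d0.+1)], and the
   machine takes at most [4002] times the cube of that. *)
exists (4002 * (K0 + 10) ^ 3)%N => M w U l hM hw l0 hl.
have [m [A [repA ew]]] := hmat M w hM hw.
have hs := hsize M w hM hw.
exists (same_traces A U); split.
- exact: same_traces_equivalence.
- move=> X X'; rewrite !powersetE => XU X'U.
  rewrite -(verdicts_agree_traces repA XU X'U) ew.
  apply: equivalence_machine_correct; first exact: supplies_equivalence.
  set x := encode_tuple _.
  have hx : ((size x).+1 <= (K0 + 10) * (l.+1 * #|M|.+1 ^ d0.+1))%N.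
    have e : (size x = size w + 3 * #|M| + size (encode_nat l) + 5)%N.
      rewrite /x size_encode_tuple /= -ew !size_encode_set.
      by move: (size w) (size (encode_nat l)) #|M| => a b c; lia.
    have sl := size_encode_nat l.
    have h1 : (#|M|.+1 ^ d0 <= #|M|.+1 ^ d0.+1)%N by rewrite leq_pexp2l.
    have h2 : (#|M|.+1 <= #|M|.+1 ^ d0.+1)%N by rewrite -{1}[#|M|.+1]expn1 leq_pexp2l.
    move: e hs sl h1 h2; move: (#|M|.+1 ^ d0)%N (#|M|.+1 ^ d0.+1)%N => u v.
    by move: (size (encode_nat l)) => sl' e hs sl h1 h2; nia.
  apply: (@leq_trans (4002 * ((K0 + 10) * (l.+1 * #|M|.+1 ^ d0.+1)) ^ 3)%N).
    by rewrite leq_mul2l leq_exp2r // hx.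
  rewrite !expnMn -expnM [(d0.+1 * 3)%N]mulnC !mulnA leq_mul2r.
  by rewrite leq_pmulr ?orbT.
- by move=> X X'; rewrite !powersetE => XU X'U; apply: same_traces_sim.
- apply: leq_trans (card_classes repA hl) _.
  by rewrite leq_pmull // expn_gt0.
Qed.
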